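(* Let $\Lambda$ be the discrete group of affine transformations of $\mathbb{R}^4$ (with coordinates $t^1,t^2,t^3,t^4$) generated by the unit translations along the $t^1$, $t^2$ and $t^3$ axes together with the map $(t^1,t^2,t^3,t^4)\mapsto(t^1+t^2,\,t^2,\,t^3,\,t^4+1)$, and let $M=\mathbb{R}^4/\Lambda$. Then $M$ is a compact four-dimensional nilmanifold; the one-forms $e^1=dt^1-t^4dt^2$, $e^2=dt^2$, $e^3=dt^3$, $e^4=dt^4$ and their dual vector fields $E_1=\frac{\partial}{\partial t^1}$, $E_2=\frac{\partial}{\partial t^2}+t^4\frac{\partial}{\partial t^1}$, $E_3=\frac{\partial}{\partial t^3}$, $E_4=\frac{\partial}{\partial t^4}$ are $\Lambda$-invariant and so descend to $M$; and $\Omega=e^1\wedge e^2+e^3\wedge e^4$ descends to a symplectic form on $M$. For each $\beta\in\mathbb{R}$, let $\nabla$ be the affine connection on $M$ determined by $$\nabla_{E_4}E_2=-(\beta-\tfrac23)E_1,\qquad \nabla_{E_2}E_4=-(\beta+\tfrac13)E_1,\qquad \nabla_{E_2}E_2=-(\beta+\tfrac13)E_3,$$ and $\nabla_{E_i}E_j=0$ for all other pairs $(i,j)$. Then for every $\beta\in\mathbb{R}$ the connection $\nabla$ is torsion-free, flat, and satisfies $\nabla\Omega=0$, and the vector field $E_2$ satisfies $\mathcal{L}_{E_2}\nabla=0$ but $\mathcal{L}_{E_2}\Omega\neq0$. In particular, there is a compact four-dimensional symplectic nilmanifold admitting a family of flat symplectic connections each of which admits an infinitesimal automorphism that is not sy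mplectic.
   Context: A nilmanifold is a quotient of a simply connected nilpotent Lie group by a discrete subgroup. A symplectic connection on a symplectic manifold $(M,\Omega)$ is a torsion-free affine connection $\nabla$ with $\nabla\Omega=0$. The Lie derivative of a torsion-free affine connection $\nabla$ along a vector field $X$ is the tensor $\mathcal{L}_X\nabla$ given by $(\mathcal{L}_X\nabla)(Y,Z)=[X,\nabla_YZ]-\nabla_{[X,Y]}Z-\nabla_Y[X,Z]$; $X$ is an infinitesimal automorphism of $\nabla$ if $\mathcal{L}_X\nabla=0$, and $X$ is symplectic if $\mathcal{L}_X\Omega=0$. A connection is flat if its curvature tensor vanishes. *)

(* Defs.v *)
From HB Require Import structures.
From mathcomp Require Import all_boot all_order all_algebra generic_quotient.
From mathcomp Require Import all_classical all_reals all_analysis.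
Set Implicit Arguments.
Unset Strict Implicit.
Unset Printing Implicit Defensive.
Import Order.TTheory GRing.Theory Num.Theory.
Import numFieldNormedType.Exports.
Local Open Scope classical_set_scope.
Local Open Scope ring_scope.
Local Open Scope quotient_scope.

Section Smooth.
Context {R : realType} {V W : normedModType R}.

(* For open [U] in a finite-dimensional [V] this is the usual C^k on [U]. *)
Fixpoint Ck_on (k : nat) (U : set V) (f : V -> W) : Prop :=
  if k is k'.+1 then
    (forall x, U x -> differentiable f x) /\ (forall v, Ck_on k' U ('D_v f))
  else forall x, U x -> {for x, continuous f}.

Definition smooth_on (U : set V) (f : V -> W) := forall k, Ck_on k U f.

End Smooth.

(* Each [par i] parametrizes the open set [par i @` cdom i] of [M], with inverse
   chart [crd i]; outside these sets the values of [par i] and [crd i] are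
   irrelevant. *)
Record atlas (R : realType) (V : normedModType R) (M : topologicalType) := Atlas {
  ix : Type;
  cdom : ix -> set V;
  par : ix -> V -> M;
  crd : ix -> M -> V
}.

Section Manifold.
Context {R : realType} {V : normedModType R} {M : topologicalType}.
Variable A : atlas V M.

Definition patch_of (i : ix A) : set M := par i @` cdom i.

Definition overlap (i j : ix A) : set V :=
  [set x | cdom i x /\ patch_of j (par i x)].

Definition transition (i j : ix A) : V -> V := crd j \o par i.

Definition smooth_manifold : Prop :=
  [/\ hausdorff_space M /\ @second_countable M,
      forall p : M, exists i : ix A, patch_of i p,
      forall i : ix A, [/\ open (cdom i), open (patch_of i) &
                    {in cdom i, cancel (par i) (crd i)}],
      forall i : ix A, (forall x, cdom i x -> {for x, continuous (par i)}) /\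
                (forall p, patch_of i p -> {for p, continuous (crd i)}) &
      forall i j : ix A, smooth_on (overlap i j) (transition i j)].

Definition smooth_fun (f : M -> R) := forall i : ix A, smooth_on (cdom i) (f \o par i).

End Manifold.

(* The open set [D] as a manifold of its own: smoothness of [F] on [D]. *)
Definition smooth_map_on (R : realType) (V W : normedModType R)
    (M N : topologicalType) (A : atlas V M) (B : atlas W N)
    (D : set M) (F : M -> N) : Prop :=
  (forall p, D p -> {for p, continuous F}) /\
  (forall (i : ix A) (j : ix B), smooth_on
     [set x | [/\ cdom i x, D (par i x) & patch_of j (F (par i x))]]
     (crd j \o F \o par i)).

Definition local_diffeo (R : realType) (V W : normedModType R)
    (M N : topologicalType) (A : atlas V M) (B : atlas W N) (F : M -> N) : Prop :=
  forall p, exists (D : set M) (g : N -> M),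
    [/\ open D /\ D p, open (F @` D), {in D, cancel F g},
        smooth_map_on A B D F & smooth_map_on B A (F @` D) g].

Definition model_atlas (R : realType) (V : normedModType R) : atlas V V :=
  Atlas (fun _ : unit => setT) (fun=> id) (fun=> id).

Definition prod_atlas (R : realType) (V W : normedModType R)
    (M N : topologicalType) (A : atlas V M) (B : atlas W N) :
    atlas (V * W)%type (M * N)%type :=
  Atlas (fun ij : ix A * ix B => cdom ij.1 `*` cdom ij.2)
        (fun ij x => (par ij.1 x.1, par ij.2 x.2))
        (fun ij p => (crd ij.1 p.1, crd ij.2 p.2)).

(* A field is a compatible family of local expressions.  Local expressions are
   extended by 0 outside the chart domain, so that fields are equal iff they are
   equal as Rocq functions; all the operations below preserve this convention
   (note that ['D_0 f x = 0]). *)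
Section Tensors.
Context {R : realType} {V : normedModType R} {M : topologicalType}.
Variable A : atlas V M.

Definition field := ix A -> V -> V.
Definition oneform := ix A -> V -> V -> R.
Definition twoform := ix A -> V -> V -> V -> R.

Definition is_field (X : field) : Prop :=
  [/\ forall i, smooth_on (cdom i) (X i),
      forall i x, ~ cdom i x -> X i x = 0 &
      forall i j x, overlap i j x ->
        X j (transition i j x) = 'D_(X i x) (transition i j) x].

Definition is_oneform (a : oneform) : Prop :=
  [/\ forall i x, scalar (a i x),
      forall i v, smooth_on (cdom i) (fun x => a i x v),
      forall i x v, ~ cdom i x -> a i x v = 0 &
      forall i j x v, overlap i j x ->
        a j (transition i j x) ('D_v (transition i j) x) = a i x v].

Definition is_twoform (w : twoform) : Prop :=
  [/\ forall i x v, [/\ scalar (w i x v), scalar (w i x ^~ v) & w i x v v = 0],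
      forall i u v, smooth_on (cdom i) (fun x => w i x u v),
      forall i x u v, ~ cdom i x -> w i x u v = 0 &
      forall i j x u v, overlap i j x ->
        w j (transition i j x) ('D_u (transition i j) x) ('D_v (transition i j) x)
          = w i x u v].

(* dw(u, v, z) for constant vectors u, v, z of the chart. *)
Definition ext_deriv (w : twoform) (i : ix A) (x u v z : V) : R :=
  'D_u (fun y => w i y v z) x - 'D_v (fun y => w i y u z) x
  + 'D_z (fun y => w i y u v) x.

Definition symplectic_form (w : twoform) : Prop :=
  [/\ is_twoform w,
      forall i x u v z, cdom i x -> ext_deriv w i x u v z = 0 &
      forall i x u, cdom i x -> (forall v, w i x u v = 0) -> u = 0].

Definition addf (X Y : field) : field := fun i x => X i x + Y i x.
Definition subf (X Y : field) : field := fun i x => X i x - Y i x.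
Definition mulf (f : M -> R) (X : field) : field :=
  fun i x => f (par i x) *: X i x.
Definition zerof : field := fun _ _ => 0.

(* [derivf X f Y] is the field (X f) Y. *)
Definition derivf (X : field) (f : M -> R) (Y : field) : field :=
  fun i x => 'D_(X i x) (f \o par i) x *: Y i x.

Definition bracket (X Y : field) : field :=
  fun i x => 'D_(X i x) (Y i) x - 'D_(Y i x) (X i) x.

(* A connection is an operator on fields; its values on families that are not
   fields are irrelevant. *)
Definition is_connection (nabla : field -> field -> field) : Prop :=
  [/\ forall X Y, is_field X -> is_field Y -> is_field (nabla X Y),
      forall X X' Y, is_field X -> is_field X' -> is_field Y ->
        nabla (addf X X') Y = addf (nabla X Y) (nabla X' Y),
      forall f X Y, smooth_fun A f -> is_field X -> is_field Y ->
        nabla (mulf f X) Y = mulf f (nabla X Y),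
      forall X Y Y', is_field X -> is_field Y -> is_field Y' ->
        nabla X (addf Y Y') = addf (nabla X Y) (nabla X Y') &
      forall f X Y, smooth_fun A f -> is_field X -> is_field Y ->
        nabla X (mulf f Y) = addf (derivf X f Y) (mulf f (nabla X Y))].

Definition torsion nabla (X Y : field) : field :=
  subf (subf (nabla X Y) (nabla Y X)) (bracket X Y).

Definition curvature nabla (X Y Z : field) : field :=
  subf (subf (nabla X (nabla Y Z)) (nabla Y (nabla X Z))) (nabla (bracket X Y) Z).

Definition torsion_free nabla : Prop :=
  forall X Y, is_field X -> is_field Y -> torsion nabla X Y = zerof.

Definition flat nabla : Prop :=
  forall X Y Z, is_field X -> is_field Y -> is_field Z ->
    curvature nabla X Y Z = zerof.

(* (nabla_X w)(Y, Z), in the chart [i], at the point of coordinate [x]. *)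
Definition cov_deriv (nabla : field -> field -> field) (w : twoform)
    (X Y Z : field) (i : ix A) (x : V) : R :=
  'D_(X i x) (fun y => w i y (Y i y) (Z i y)) x
  - w i x (nabla X Y i x) (Z i x) - w i x (Y i x) (nabla X Z i x).

Definition parallel nabla (w : twoform) : Prop :=
  forall X Y Z, is_field X -> is_field Y -> is_field Z ->
  forall i x, cdom i x -> cov_deriv nabla w X Y Z i x = 0.

Definition symplectic_connection (w : twoform) nabla : Prop :=
  [/\ is_connection nabla, torsion_free nabla & parallel nabla w].

Definition lie_connection (X : field) nabla (Y Z : field) : field :=
  subf (subf (bracket X (nabla Y Z)) (nabla (bracket X Y) Z))
       (nabla Y (bracket X Z)).

Definition lie_form (X : field) (w : twoform) (Y Z : field)
    (i : ix A) (x : V) : R :=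
  'D_(X i x) (fun y => w i y (Y i y) (Z i y)) x
  - w i x (bracket X Y i x) (Z i x) - w i x (Y i x) (bracket X Z i x).

Definition infinitesimal_automorphism nabla (X : field) : Prop :=
  forall Y Z, is_field Y -> is_field Z -> lie_connection X nabla Y Z = zerof.

Definition symplectic_field (w : twoform) (X : field) : Prop :=
  forall Y Z, is_field Y -> is_field Z ->
  forall i x, cdom i x -> lie_form X w Y Z i x = 0.

End Tensors.
Arguments zerof {R V M} A _ _.

Definition discrete_set (T : topologicalType) (D : set T) := D `<=` isolated D.

Section Groups.
Context {G : Type}.
Variables (mul : G -> G -> G) (inv : G -> G) (one : G).

Definition is_group :=
  [/\ associative mul, left_id one mul & left_inverse one inv mul].

Definition is_subgroup (H : set G) :=
  [/\ H one, forall x y, H x -> H y -> H (mul x y) & forall x, H x -> H (inv x)].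

Definition commutator x y := mul (mul (inv x) (inv y)) (mul x y).

Fixpoint lower_central (k : nat) : set G :=
  if k is k'.+1 then
    smallest is_subgroup
      [set z | exists x y, lower_central k' y /\ z = commutator x y]
  else setT.

Definition nilpotent_group := exists k, lower_central k = [set one].

End Groups.

Definition lie_group (R : realType) (V : normedModType R) (G : topologicalType)
    (B : atlas V G) (mul : G -> G -> G) (inv : G -> G) (one : G) : Prop :=
  [/\ smooth_manifold B, is_group mul inv one,
      smooth_map_on (prod_atlas B B) B setT (fun xy => mul xy.1 xy.2) &
      smooth_map_on B B setT inv].

Definition simply_connected (R : realType) (G : topologicalType) : Prop :=
  let I := `[0, 1]%classic : set R in
  let path (g : R -> G) x y :=
    [/\ {within I, continuous g}, g 0 = x & g 1 = y] in
  [/\ [set: G] !=set0,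
      forall x y : G, exists g, path g x y &
      forall (x : G) (g : R -> G), path g x x ->
        exists H : R * R -> G,
          [/\ {within I `*` I, continuous H},
              forall s, I s -> H (0, s) = g s,
              forall s, I s -> H (1, s) = x &
              forall r, I r -> H (r, 0) = x /\ H (r, 1) = x]].

(* The manifold M is the quotient of the Lie group G by the left action of the
   discrete subgroup [Gam], with p the projection. *)
Definition nilmanifold (R : realType) (V : normedModType R) (M : topologicalType)
    (A : atlas V M) : Prop :=
  exists (G : topologicalType) (B : atlas V G)
         (mul : G -> G -> G) (inv : G -> G) (one : G)
         (Gam : set G) (p : G -> M),
    [/\ lie_group B mul inv one,
        simply_connected R G /\ nilpotent_group mul inv one,
        is_subgroup mul inv one Gam /\ discrete_set Gam,
        set_surj setT setT p /\
          (forall x y, p x = p y <-> exists2 g, Gam g & mul g x = y) &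
        local_diffeo B A p].

Definition is_transformation_group (T : Type) (G : set (T -> T)) : Prop :=
  [/\ G id, forall f g, G f -> G g -> G (f \o g) &
      forall f, G f -> exists2 g, G g & cancel f g /\ cancel g f].

Record transformation_group (T : Type) := TransformationGroup {
  tg_set : set (T -> T);
  tgP : is_transformation_group tg_set
}.

Section OrbitSpace.
Context {T : topologicalType}.
Variable G : transformation_group T.

Definition orbit_rel (x y : T) : bool := `[< exists2 g, tg_set G g & g x = y >].

Lemma orbit_rel_equiv : equiv_class_of orbit_rel.
Proof.
have [G1 GM GV] := tgP G.
split=> [x|x y|y x z].
- by apply/asboolP; exists id.
- by apply/idP/idP => /asboolP[g /GV[h Gh [gK _]] <-]; apply/asboolP; exists h.
- move=> /asboolP[g Gg <-] /asboolP[h Gh <-]; apply/asboolP.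
  by exists (h \o g) => //; exact: GM.
Qed.

Canonical orbit_equiv := EquivRelPack orbit_rel_equiv.

Definition orbit_space : topologicalType :=
  quotient_topology {eq_quot orbit_equiv}.

Definition orbit_proj (x : T) : orbit_space :=
  \pi_(quotient_topology {eq_quot orbit_equiv}) x.

End OrbitSpace.

(* The atlas of local inverses of the projection [V -> V / G]: its charts are the
   open sets of [V] on which the projection is injective. *)
Section OrbitAtlas.
Context {R : realType} {V : normedModType R}.
Variable G : transformation_group V.

Definition orbit_atlas : atlas V (orbit_space G) :=
  Atlas
    (fun U : {U : set V | open U /\ {in U &, injective (orbit_proj G)}} => sval U)
    (fun _ => orbit_proj G)
    (fun U p => xget 0 [set x | sval U x /\ orbit_proj G x = p]).

Definition descend_field (X : V -> V) : field orbit_atlas :=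
  fun U => patch (fun=> 0) (sval U) X.
Definition descend_oneform (a : V -> V -> R) : oneform orbit_atlas :=
  fun U => patch (fun=> fun=> 0) (sval U) a.
Definition descend_twoform (w : V -> V -> V -> R) : twoform orbit_atlas :=
  fun U => patch (fun=> fun=> fun=> 0) (sval U) w.

Definition invariant_field (X : V -> V) : Prop :=
  forall g, tg_set G g -> forall x, X (g x) = 'D_(X x) g x.
Definition invariant_oneform (a : V -> V -> R) : Prop :=
  forall g, tg_set G g -> forall x v, a (g x) ('D_v g x) = a x v.

End OrbitAtlas.
Arguments descend_field {R V} G X.
Arguments descend_oneform {R V} G a.
Arguments descend_twoform {R V} G w.
Arguments invariant_field {R V} G X.
Arguments invariant_oneform {R V} G a.

Definition i1 : 'I_4 := @Ordinal 4 0 isT.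
Definition i2 : 'I_4 := @Ordinal 4 1 isT.
Definition i3 : 'I_4 := @Ordinal 4 2 isT.
Definition i4 : 'I_4 := @Ordinal 4 3 isT.

Section Example.
Variable R : realType.
Local Notation V := 'rV[R]_4.

Definition vec4 (a b c d : R) : V := \row_i [:: a; b; c; d]`_i.

Definition dd (k : 'I_4) : V := delta_mx ord0 k.

Definition translation (k : 'I_4) (t : V) : V := t + dd k.

Definition shear (t : V) : V :=
  vec4 (t ord0 i1 + t ord0 i2) (t ord0 i2) (t ord0 i3) (t ord0 i4 + 1).

Definition Lambda_set : set (V -> V) :=
  smallest (@is_transformation_group V)
    [set f | [\/ f = translation i1, f = translation i2, f = translation i3
             | f = shear]].

Lemma Lambda_setP : is_transformation_group Lambda_set.
Proof.
pose bij := [set f : V -> V | exists g, cancel f g /\ cancel g f].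
have bijP : is_transformation_group bij.
  split=> [|f g [f' [fK f'K]] [g' [gK g'K]]|f [g [fK gK]]].
  - by exists id.
  - by exists (g' \o f'); split; apply: can_comp.
  - by exists g => //; exists f.
have gen_bij : [set f | [\/ f = translation i1, f = translation i2,
    f = translation i3 | f = shear]] `<=` bij.
  have tr k : bij (translation k).
    by exists (fun t => t - dd k); split=> t; rewrite /translation ?addrK ?subrK.
  move=> f [] ->; [exact: tr|exact: tr|exact: tr|].
  exists (fun t => vec4 (t ord0 i1 - t ord0 i2) (t ord0 i2) (t ord0 i3)
                        (t ord0 i4 - 1)).
  by split=> t; apply/rowP=> -[[|[|[|[|//]]]] ?];
    rewrite !mxE /= ?addrK ?subrK //; congr (t _ _); exact: val_inj.
split=> [|f g Lf Lg|f Lf].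
- by move=> H [[]].
- by move=> H HP; have [[_ HM _] _] := HP; apply: HM; [exact: Lf|exact: Lg].
- have [g [fK gK]] : bij f by exact: Lf.
  exists g => // H HP; have [[_ _ HV] _] := HP.
  have [h Hh [fhK hK]] := HV _ (Lf _ HP).
  suff -> : g = h by [].
  by apply/funext => x; rewrite -[RHS]fK hK.
Qed.

Definition Lambda : transformation_group V := TransformationGroup Lambda_setP.

Definition affine_map (Ab : 'M[R]_4 * V) (t : V) : V := t *m Ab.1 + Ab.2.

Definition nilM : topologicalType := orbit_space Lambda.
Definition nilA : atlas V nilM := orbit_atlas Lambda.

Definition E (k : 'I_4) (t : V) : V :=
  [:: dd i1; dd i2 + t ord0 i4 *: dd i1; dd i3; dd i4]`_k.

Definition e (k : 'I_4) (t v : V) : R :=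
  [:: v ord0 i1 - t ord0 i4 * v ord0 i2; v ord0 i2; v ord0 i3; v ord0 i4]`_k.

Definition wedge (a b : V -> V -> R) (t u v : V) : R :=
  a t u * b t v - a t v * b t u.

Definition Omega (t u v : V) : R :=
  wedge (e i1) (e i2) t u v + wedge (e i3) (e i4) t u v.

Definition nilE (k : 'I_4) : field nilA := descend_field Lambda (E k).
Definition nile (k : 'I_4) : oneform nilA := descend_oneform Lambda (e k).
Definition nilOmega : twoform nilA := descend_twoform Lambda Omega.

Definition nabla_spec (beta : R)
    (nabla : field nilA -> field nilA -> field nilA) : Prop :=
  [/\ nabla (nilE i4) (nilE i2) = mulf (fun=> - (beta - 2 / 3)) (nilE i1),
      nabla (nilE i2) (nilE i4) = mulf (fun=> - (beta + 1 / 3)) (nilE i1),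
      nabla (nilE i2) (nilE i2) = mulf (fun=> - (beta + 1 / 3)) (nilE i3) &
      forall i j : 'I_4, (i, j) \notin [:: (i4, i2); (i2, i4); (i2, i2)] ->
        nabla (nilE i) (nilE j) = zerof nilA].

End Example.
Arguments Lambda_set R _ : clear implicits.
Arguments nilE R k _ _ : clear implicits.
Arguments nile R k _ _ _ : clear implicits.
Arguments nilOmega R _ _ _ _ : clear implicits.

(* Main.v *)
(* The group Lambda consists of the left translations by integer points for the
   group law (s, t) |-> (s^1 + t^1 + s^4 t^2, s^2 + t^2, s^3 + t^3, s^4 + t^4) on
   R^4.  In the coordinates t^k the form Omega has constant coefficients, and so
   has each connection nabla: as nabla E_2 contains the derivative of t^4, its
   Christoffel symbols are the constant symmetric ones
     Gamma^1_24 = Gamma^1_42 = Gamma^3_22 = - (beta + 1/3).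
   Torsion, curvature, nabla Omega and L_X nabla for an affine field X thus reduce
   to algebraic identities for a bilinear map C, the second-order terms
   cancelling by Schwarz's theorem.  Since the E_k form a global frame, a
   connection is determined by its values on them. *)

Require Import Defs.
From HB Require Import structures.
From mathcomp Require Import all_boot all_order all_algebra.
From mathcomp Require Import all_classical all_reals all_analysis.
From mathcomp Require Import ring lra.
Import Order.TTheory GRing.Theory Num.Theory.
Import numFieldNormedType.Exports.
Local Open Scope classical_set_scope.
Local Open Scope ring_scope.
Set Implicit Arguments.
Unset Strict Implicit.
Unset Printing Implicit Defensive.

(* [fraction] has operations of the same names. *)
Local Notation addf := Defs.addf.
Local Notation mulf := Defs.mulf.

(** * Calculus of smooth maps *)

(** A connection is here an arbitrary operator, constrained only on smooth fields and prescribed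
    only on the frame, so nothing can be computed with it directly. An explicit model is built,
    agreement with it on all fields is proved, and the properties are carried over. The frame and
    its dual coframe are global, so the coefficients of a field are smooth functions on the whole of
    M; this replaces the usual localisation by cutoff functions. The shape of the Christoffel
    symbols C is explained by a cubic. With b = beta + 1/3, Omega(C(u, v), z) = - b (u^4 v^2 z^2 +
    u^2 v^4 z^2 + u^2 v^2 z^4) is totally symmetric, the polarisation of - 3 b (x^2)^2 x^4 up to the
    usual factor. Symmetry in u and v is the absence of torsion; symmetry in v and z, Omega being
    alternating, is nabla Omega = 0. *)

Section SmoothCalculus.
Context {R : realType}.
Implicit Types V W : normedModType R.

Lemma near_eq_differentiable V W (f g : V -> W) x :
  (\forall y \near x, f y = g y) -> differentiable g x -> differentiable f x.
Proof.
move=> fg dg.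
have E : f \o shift x = cst (f x) + 'd g x +o_ 0 id.
  apply/eqaddoP => _/posnumP[e].
  have := diff_locally dg => /eqaddoP /(_ _ (gt0 e)).
  apply: filter_app.
  have : \forall h \near (0 : V), f (h + x) = g (h + x).
    move: (fg); rewrite (near_shift (0 : V)) subr0.
    by apply: filterS => h.
  apply: filter_app; apply: nearW => h fgh.
  by rewrite !fctE /= fgh (nbhs_singleton fg).
(* By uniqueness of the first-order expansion, [E] identifies the differential of [f] at [x] with
   that of [g]. *)
have dc := diff_continuous dg.
by apply/diff_locallyP; rewrite (diff_unique dc E).
Qed.

(** [Ck_on] constrains derivatives only at the points of its set, so a local model of class C^k at
    the single point [x] suffices. This gives smoothness on sets where the formula for [f] changes
    from place to place. *)
Lemma Ck_on_near V W k (U : set V) (f : V -> W) :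
  (forall x, U x -> exists g, Ck_on k [set x] g /\ \forall y \near x, f y = g y) ->
  Ck_on k U f.
Proof.
elim: k U f => [|k IH] U f H /=.
  move=> x /H[g [/(_ x erefl) gc fg]].
  rewrite /prop_for /continuous_at (nbhs_singleton fg).
  apply: cvg_trans gc; apply: near_eq_cvg.
  by apply: filterS fg => y ->.
split=> [x /H[g [[/(_ x erefl) gd _] fg]]|v].
  exact: near_eq_differentiable fg gd.
apply: IH => x /H[g [[_ /(_ v) gd] fg]]; exists ('D_v g); split=> //.
by apply: filterS (nbhs_interior fg) => y; exact: near_eq_derive.
Qed.

Lemma Ck_on_sub V W k (U U' : set V) (f : V -> W) :
  U' `<=` U -> Ck_on k U f -> Ck_on k U' f.
Proof.
elim: k U U' f => [|k IH] U U' f UU' /=; first by move=> H x /UU'; exact: H.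
by move=> [H1 H2]; split=> [x /UU'/H1|v]; [|exact: IH UU' (H2 v)].
Qed.

Lemma smooth_on_sub V W (U U' : set V) (f : V -> W) :
  U' `<=` U -> smooth_on U f -> smooth_on U' f.
Proof. by move=> UU' H k; exact: Ck_on_sub UU' (H k). Qed.

Lemma smooth_on_near V W (U : set V) (f : V -> W) :
  (forall x, U x -> exists (O : set V) g,
    [/\ O x, smooth_on O g & \forall y \near x, f y = g y]) ->
  smooth_on U f.
Proof.
move=> H k; apply: Ck_on_near => x /H[] D [] g [Dx sg fg]; exists g; split=> //.
by apply: Ck_on_sub (sg k) => _ ->.
Qed.

Lemma open_near V (U : set V) (P : V -> Prop) x :
  open U -> U x -> (forall y, U y -> P y) -> \forall y \near x, P y.
Proof. by move=> oU Ux UP; apply: filterS (open_nbhs_nbhs (conj oU Ux)). Qed.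

Lemma Ck_on_eq V W k (U : set V) (f g : V -> W) : open U ->
  (forall x, U x -> f x = g x) -> Ck_on k U g -> Ck_on k U f.
Proof.
move=> oU fg sg; apply: Ck_on_near => x Ux; exists g; split.
  by apply: Ck_on_sub sg => _ ->.
exact: open_near oU Ux fg.
Qed.

Lemma smooth_on_eq V W (U : set V) (f g : V -> W) : open U ->
  (forall x, U x -> f x = g x) -> smooth_on U g -> smooth_on U f.
Proof. by move=> oU fg sg k; exact: Ck_on_eq oU fg (sg k). Qed.

Lemma Ck_on_cst V W k (U : set V) (c : W) : Ck_on k U (cst c).
Proof.
elim: k c => [|k IH] c /=; first by move=> x _; exact: cvg_cst.
split=> [x _|v]; first exact: differentiable_cst.
have -> : 'D_v (cst c) = cst (0 : W) :> (V -> W); last exact: IH.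
by apply/funext => x; rewrite derive_cst.
Qed.

Lemma Ck_on_pred V W k (U : set V) (f : V -> W) :
  Ck_on k.+1 U f -> Ck_on k U f.
Proof.
elim: k f => [|k IH] f [df sf].
  by move=> x /df; exact: differentiable_continuous.
by split=> // v; apply: IH; exact: sf.
Qed.

Lemma smooth_on_cst V W (U : set V) (c : W) : smooth_on U (cst c).
Proof. by move=> k; exact: Ck_on_cst. Qed.

Lemma smooth_on_differentiable V W (U : set V) (f : V -> W) x :
  smooth_on U f -> U x -> differentiable f x.
Proof. by move=> /(_ 1%N)[df _]; exact: df. Qed.

Lemma smooth_on_derivable V W (U : set V) (f : V -> W) x v :
  smooth_on U f -> U x -> derivable f x v.
Proof.
by move=> sf Ux; exact/diff_derivable/(smooth_on_differentiable sf Ux).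
Qed.

Lemma smooth_on_derive V W (U : set V) (f : V -> W) v :
  smooth_on U f -> smooth_on U ('D_v f).
Proof. by move=> H k; have [_ /(_ v)] := H k.+1. Qed.

Lemma smooth_on_linear V W (U : set V) (f : {linear V -> W}) :
  continuous f -> smooth_on U f.
Proof.
move=> fc [|k] /=; first by move=> x _; exact: fc.
split=> [x _|v]; first exact: linear_differentiable.
have -> : 'D_v f = cst (f v); last exact: Ck_on_cst.
apply/funext => x; rewrite deriveE ?diff_lin //.
exact: linear_differentiable.
Qed.

Lemma Ck_on_add V W k (U : set V) (f g : V -> W) : open U ->
  Ck_on k U f -> Ck_on k U g -> Ck_on k U (fun x => f x + g x).
Proof.
move=> oU; elim: k f g => [|k IH] f g /=.
  by move=> cf cg x Ux; apply: cvgD; [exact: cf|exact: cg].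
move=> [df sf] [dg sg]; split=> [x Ux|v].
  by apply: differentiableD; [exact: df|exact: dg].
apply: (Ck_on_eq oU _ (IH _ _ (sf v) (sg v))) => x Ux.
by apply: deriveD; apply/diff_derivable; [exact: df|exact: dg].
Qed.

Lemma smooth_on_add V W (U : set V) (f g : V -> W) : open U ->
  smooth_on U f -> smooth_on U g -> smooth_on U (fun x => f x + g x).
Proof. by move=> oU sf sg k; exact: Ck_on_add. Qed.

(** Scaling is registered as a bilinear map so that its product rule becomes an instance of the
    differential of a bilinear map. *)
Lemma scaler_is_bilinear W : bilinear_for
    (GRing.Scale.Law.clone _ _ *:%R _) (GRing.Scale.Law.clone _ _ *:%R _)
    ( *:%R : R -> W -> W).
Proof.
split=> [u|u] a x y /=; first by rewrite scalerDl -scalerA.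
rewrite scalerDr; congr (_ + _); rewrite !scalerA; congr (_ *: _).
exact: mulrC.
Qed.

HB.instance Definition _ W := bilinear_isBilinear.Build R R W W _ _
  ( *:%R : R -> W -> W) (@scaler_is_bilinear W).

Lemma differentiable_scale V W (f : V -> R) (g : V -> W) x :
  differentiable f x -> differentiable g x ->
  differentiable (fun y => f y *: g y) x /\
  forall v, 'D_v (fun y => f y *: g y) x = f x *: 'D_v g x + 'D_v f x *: g x.
Proof.
move=> df dg.
have Bc : continuous (fun p : R * W => ( *:%R : R -> W -> W) p.1 p.2).
  by move=> p; exact: scale_continuous.
have dp := differentiable_pair df dg.
have dB := differentiable_bilin (f x, g x) Bc.
have -> : (fun y => f y *: g y) =
   (fun p : R * W => p.1 *: p.2) \o (fun y => (f y, g y)) by [].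
have dc := differentiable_comp dp dB.
split=> // v; rewrite deriveE // diff_comp // (diff_bilin _ Bc) diff_pair //=.
by rewrite -!deriveE.
Qed.

(** The derivative of the product contains an undifferentiated factor in each term; [Ck_on_pred]
    lowers it to the order of the induction hypothesis. *)
Lemma Ck_on_scale V W k (U : set V) (f : V -> R) (g : V -> W) : open U ->
  Ck_on k U f -> Ck_on k U g -> Ck_on k U (fun x => f x *: g x).
Proof.
move=> oU; elim: k f g => [|k IH] f g /=.
  by move=> cf cg x Ux; apply: cvgZ; [exact: cf|exact: cg].
move=> skf skg; have [df sf] := skf; have [dg sg] := skg; split=> [x Ux|v].
  by have [] := differentiable_scale (df x Ux) (dg x Ux).
apply: (Ck_on_eq oU _ (Ck_on_add oU (IH _ _ (Ck_on_pred skf) (sg v))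
                                    (IH _ _ (sf v) (Ck_on_pred skg)))) => x Ux.
by have [_ ->] := differentiable_scale (df x Ux) (dg x Ux).
Qed.

Lemma smooth_on_scale V W (U : set V) (f : V -> R) (g : V -> W) : open U ->
  smooth_on U f -> smooth_on U g -> smooth_on U (fun x => f x *: g x).
Proof. by move=> oU sf sg k; exact: Ck_on_scale. Qed.

Lemma smooth_on_mul V (U : set V) (f g : V -> R) : open U ->
  smooth_on U f -> smooth_on U g -> smooth_on U (fun x => f x * g x).
Proof. by move=> oU sf sg; exact: smooth_on_scale. Qed.

Lemma smooth_on_sum V W (U : set V) (I : Type) (r : seq I) (F : I -> V -> W) :
  open U -> (forall i, smooth_on U (F i)) ->
  smooth_on U (fun x => \sum_(i <- r) F i x).
Proof.
move=> oU sF; elim: r => [|i r IH].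
  by apply: (smooth_on_eq oU _ (smooth_on_cst U 0)) => x _; rewrite big_nil.
apply: (smooth_on_eq oU _ (smooth_on_add oU (sF i) IH)) => x _.
by rewrite big_cons.
Qed.

Lemma derive_linear_comp V W (W' : normedModType R) (L : {linear W -> W'})
    (f : V -> W) x v :
  continuous L -> differentiable f x -> 'D_v (L \o f) x = L ('D_v f x).
Proof.
move=> Lc df; have dL := linear_differentiable (f x) Lc.
rewrite deriveE; last exact: differentiable_comp.
by rewrite diff_comp //= diff_lin // -deriveE.
Qed.

Lemma smooth_on_linear_comp V W (W' : normedModType R) (L : {linear W -> W'})
    (U : set V) (f : V -> W) : open U ->
  continuous L -> smooth_on U f -> smooth_on U (L \o f).
Proof.
move=> oU Lc sf k; elim: k f {sf}(sf k) => [|k IH] f /=.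
  move=> cf x Ux; apply: continuous_comp; [exact: cf|exact: Lc].
move=> [df sf]; split=> [x Ux|v].
  by apply: differentiable_comp; [exact: df|exact: linear_differentiable].
apply: (Ck_on_eq oU _ (IH _ (sf v))) => x Ux.
by rewrite derive_linear_comp //; exact: df.
Qed.

Lemma smooth_on_coord m n (U : set 'M[R]_(m, n)) i j :
  smooth_on U (fun N : 'M[R]_(m, n) => N i j).
Proof.
pose L : 'M[R]_(m, n) -> R := fun N => N i j.
have Ll : linear L by move=> a u v; rewrite /L !mxE.
pose b := GRing.isLinear.Build _ _ _ _ L Ll.
pose LL : {linear 'M[R]_(m, n) -> R} := HB.pack L b.
by apply: (@smooth_on_linear _ _ U LL) => x; exact: coord_continuous.
Qed.

Lemma smooth_on_coord_comp V m n (U : set V) (f : V -> 'M[R]_(m, n)) i j :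
  open U -> smooth_on U f -> smooth_on U (fun x => f x i j).
Proof.
move=> oU sf.
pose L : 'M[R]_(m, n) -> R := fun N => N i j.
have Ll : linear L by move=> a u v; rewrite /L !mxE.
pose b := GRing.isLinear.Build _ _ _ _ L Ll.
pose LL : {linear 'M[R]_(m, n) -> R} := HB.pack L b.
by apply: (@smooth_on_linear_comp _ _ _ LL) => // x; exact: coord_continuous.
Qed.

Lemma smooth_on_row V n (U : set V) (f : V -> 'rV[R]_n) : open U ->
  (forall j, smooth_on U (fun x => f x ord0 j)) -> smooth_on U f.
Proof.
move=> oU sf.
apply: (smooth_on_eq oU (g := fun x => \sum_j f x ord0 j *: delta_mx ord0 j)).
  by move=> x _; rewrite -row_sum_delta.
apply: smooth_on_sum => // j; apply: smooth_on_scale => //.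
exact: smooth_on_cst.
Qed.

Lemma derive_sumE n W (f : 'rV[R]_n -> W) x v : differentiable f x ->
  'D_v f x = \sum_j v ord0 j *: 'D_(delta_mx ord0 j) f x.
Proof.
move=> df; rewrite deriveE // [in LHS](row_sum_delta v) linear_sum.
by apply: eq_bigr => j _; rewrite linearZ deriveE.
Qed.

(** Smoothness speaks of derivatives in constant directions only; a variable direction is reduced to
    these by expanding it in the standard basis. *)
Lemma smooth_on_derive_along n W (U : set 'rV[R]_n)
    (X : 'rV[R]_n -> 'rV[R]_n) (f : 'rV[R]_n -> W) : open U ->
  smooth_on U X -> smooth_on U f -> smooth_on U (fun x => 'D_(X x) f x).
Proof.
move=> oU sX sf.
apply: (smooth_on_eq oU
  (g := fun x => \sum_j X x ord0 j *: 'D_(delta_mx ord0 j) f x)).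
  by move=> x Ux; rewrite derive_sumE //; exact: smooth_on_differentiable sf Ux.
apply: smooth_on_sum => // j; apply: smooth_on_scale => //.
  exact: smooth_on_coord_comp.
exact: smooth_on_derive.
Qed.

Lemma deriveDv V W (f : V -> W) x u v : differentiable f x ->
  'D_(u + v) f x = 'D_u f x + 'D_v f x.
Proof. by move=> df; rewrite !deriveE // linearD. Qed.

Lemma deriveNv V W (f : V -> W) x u : differentiable f x ->
  'D_(- u) f x = - 'D_u f x.
Proof. by move=> df; rewrite !deriveE // linearN. Qed.

Lemma deriveZv V W (f : V -> W) x (a : R) u : differentiable f x ->
  'D_(a *: u) f x = a *: 'D_u f x.
Proof. by move=> df; rewrite !deriveE // linearZ. Qed.

(* The left-hand side is symmetric in [u] and [v]: exchanging them and letting [h]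
   tend to 0 gives Schwarz's theorem. *)
Lemma second_difference V (U : set V) (f : V -> R) x u v (h : R) : 0 < h ->
  smooth_on U f ->
  (forall s t, 0 <= s <= h -> 0 <= t <= h -> U (x + s *: u + t *: v)) ->
  exists s t, [/\ 0 <= s <= h, 0 <= t <= h &
    f (x + h *: u + h *: v) - f (x + h *: u) - f (x + h *: v) + f x =
    'D_v ('D_u f) (x + s *: u + t *: v) * h ^+ 2].
Proof.
move=> h0 sf HU.
have hh : 0 <= h <= h by rewrite lexx ltW.
have h00 : 0 <= (0 : R) <= h by rewrite lexx ltW.
have line (g : V -> R) y w (s : R) : differentiable g (y + s *: w) ->
    is_derive s 1 (fun s => g (y + s *: w)) ('D_w g (y + s *: w)).
  move=> dg; have dl : is_diff s (fun s : R => y + s *: w) ( *:%R^~ w).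
    have -> : (fun s : R => y + s *: w) = cst y + ( *:%R^~ w) by [].
    exact: is_diff_eq (is_diffD (is_diff_cst y s) (is_diff_scalel s w)) (add0r _).
  have dgl : differentiable (g \o (fun s => y + s *: w)) s.
    exact: differentiable_comp.
  apply: DeriveDef; first exact: diff_derivable.
  rewrite deriveE // diff_comp //= deriveE //; congr ('d g _ _).
  by rewrite diff_val scale1r.
have line_cont (g : R -> R) (dg : R -> R) :
   (forall s, 0 <= s <= h -> is_derive s 1 g (dg s)) ->
   exists2 c, 0 <= c <= h & g h - g 0 = dg c * h.
  move=> H; have [||c] := @MVT_segment R g dg 0 h (ltW h0).
  - by move=> s; rewrite in_itv /= => /andP[a b]; apply: H; rewrite !ltW.
  - apply: derivable_within_continuous => s; rewrite in_itv /= => /H dgs.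
    exact: ex_derive.
  - by rewrite in_itv /= subr0 => ? ?; exists c.
(* The mean value theorem is used twice: in the direction [u] for the increment of [f] along
   [h *: v], then in the direction [v] for ['D_u f]. *)
pose phi (s : R) := f (x + s *: u + h *: v) - f (x + s *: u).
pose dphi (s : R) := 'D_u f (x + s *: u + h *: v) - 'D_u f (x + s *: u).
have HU0 s : 0 <= s <= h -> U (x + s *: u).
  by move=> sh; have := HU s 0 sh h00; rewrite scale0r addr0.
have [s sh Es] : exists2 s, 0 <= s <= h & phi h - phi 0 = dphi s * h.
  apply: line_cont => s sh; apply: is_deriveB.
    have -> : (fun s : R => f (x + s *: u + h *: v)) =
              (fun s => f (x + h *: v + s *: u)).
      by apply/funext => r; rewrite addrAC.
    rewrite addrAC; apply: line; rewrite addrAC.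
    by apply: smooth_on_differentiable sf _; exact: HU.
  by apply: line; apply: smooth_on_differentiable sf _; exact: HU0.
have [t th Et] : exists2 t, 0 <= t <= h &
    'D_u f (x + s *: u + h *: v) - 'D_u f (x + s *: u + 0 *: v) =
    'D_v ('D_u f) (x + s *: u + t *: v) * h.
  apply: (line_cont (fun t => 'D_u f (x + s *: u + t *: v))) => t th.
  apply: line; apply: smooth_on_differentiable (smooth_on_derive u sf) _.
  exact: HU.
exists s, t; split=> //; rewrite expr2 mulrA -Et scale0r addr0 -/(dphi s) -Es.
by rewrite /phi scale0r addr0; ring.
Qed.

Lemma Schwarz V (U : set V) (f : V -> R) x u v : open U -> U x ->
  smooth_on U f -> 'D_u ('D_v f) x = 'D_v ('D_u f) x.
Proof.
move=> oU Ux sf.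
pose G := 'D_u ('D_v f); pose H := 'D_v ('D_u f).
have cG : {for x, continuous G}.
  by apply: (smooth_on_derive u (smooth_on_derive v sf) 0%N).
have cH : {for x, continuous H}.
  by apply: (smooth_on_derive v (smooth_on_derive u sf) 0%N).
have tri (e a b p q : R) : p = q -> `|a - p| < e / 2 -> `|b - q| < e / 2 ->
    `|a - b| <= e.
  move=> -> ap bq; rewrite (_ : a - b = (a - q) - (b - q)); last by ring.
  by apply: le_trans (ler_normB _ _) _; rewrite (splitr e) lerD // ltW.
apply/eqP; rewrite -subr_eq0 -normr_le0; apply/ler_addgt0Pl => e e0.
rewrite addr0; have e20 : 0 < e / 2 by rewrite divr_gt0.
have : \forall y \near x, U y /\ (`|G x - G y| < e / 2 /\ `|H x - H y| < e / 2).
  apply: filterI; first exact: open_nbhs_nbhs.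
  apply: filterI.
    by move/cvgrPdist_lt : cG; apply.
  by move/cvgrPdist_lt : cH; apply.
move=> /nbhs_ballP[d /= d0 Hd].
(* This [h] keeps the parallelogram spanned by [h *: u] and [h *: v] inside the ball of radius [d];
   the summand 1 keeps the denominator positive when [u] and [v] vanish. *)
pose h := d / 2 / (1 + `|u| + `|v|).
have K0 : 0 < 1 + `|u| + `|v| by rewrite -addrA ltr_pwDl // addr_ge0.
have h0 : 0 < h by rewrite !divr_gt0.
have inb s t : 0 <= s <= h -> 0 <= t <= h -> ball x d (x + s *: u + t *: v).
  move=> /andP[s0 sh] /andP[t0 th].
  rewrite -ball_normE /= -addrA opprD addrA subrr sub0r normrN.
  apply: le_lt_trans (ler_normD _ _) _; rewrite !normrZ !ger0_norm //.
  apply: le_lt_trans (_ : h * (1 + `|u| + `|v|) < _).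
    rewrite !mulrDr mulr1 -addrA ler_wpDl ?(ltW h0) //.
    by apply: lerD; apply: ler_wpM2r.
  by rewrite /h divfK ?gt_eqF // ltr_pdivrMr // ltr_pMr // ltr1n.
have [s [t [sh th E1]]] := second_difference (v := v) (u := u) h0 sf
  (fun s t sh th => (Hd _ (inb s t sh th)).1).
have inb' s' t' : 0 <= s' <= h -> 0 <= t' <= h -> ball x d (x + s' *: v + t' *: u).
  by move=> sh' th'; rewrite addrAC; exact: inb.
have [s' [t' [sh' th' E2]]] := second_difference (v := u) (u := v) h0 sf
  (fun s t sh th => (Hd _ (inb' s t sh th)).1).
(* Both mean values equal the same second difference divided by [h ^+ 2]. *)
have GH : G (x + s' *: v + t' *: u) = H (x + s *: u + t *: v).
  apply: (mulIf (x := h ^+ 2)); first by rewrite sqrf_eq0 gt_eqF.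
  apply: (etrans (esym E2)); apply: (etrans _ E1).
  have -> : x + h *: v + h *: u = x + h *: u + h *: v by rewrite addrAC.
  by congr (_ + _); exact: addrAC.
have [_ [_ Hb]] := Hd _ (inb s t sh th).
have [_ [Gb _]] := Hd _ (inb' s' t' sh' th').
exact: tri GH Gb Hb.
Qed.

End SmoothCalculus.

(** * Second derivatives along vector fields *)

Section SecondOrder.
Context {R : realType} {n m : nat}.
Implicit Types (X Y : 'rV[R]_n -> 'rV[R]_n) (Z : 'rV[R]_n -> 'rV[R]_m).

Lemma derive_coord (V : normedModType R) p q (f : V -> 'M[R]_(p, q)) x v i j :
  differentiable f x -> 'D_v (fun y => f y i j) x = 'D_v f x i j.
Proof.
by move=> df; rewrite [in RHS]derive_mx ?mxE //; exact: diff_derivable.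
Qed.

Lemma Schwarz_row (U : set 'rV[R]_n) Z x u v : open U -> U x ->
  smooth_on U Z -> 'D_u ('D_v Z) x = 'D_v ('D_u Z) x.
Proof.
move=> oU Ux sZ.
have E (a b : 'rV[R]_n) j :
    'D_a ('D_b Z) x ord0 j = 'D_a ('D_b (fun y => Z y ord0 j)) x.
  rewrite -derive_coord; last first.
    exact: smooth_on_differentiable (smooth_on_derive b sZ) Ux.
  apply: near_eq_derive; apply: (open_near oU Ux) => y Uy.
  by rewrite derive_coord //; exact: smooth_on_differentiable sZ Uy.
apply/rowP => j; apply: (etrans (E u v j)); apply: (etrans _ (esym (E v u j))).
exact: Schwarz u v oU Ux (smooth_on_coord_comp ord0 j oU sZ).
Qed.

(** A product rule in which the direction counts as a factor: the last term has its direction frozen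
    at [Y x] and is the only one of second order in [Z]. *)
Lemma derive_derive_along (U : set 'rV[R]_n) Y Z x v : open U -> U x ->
  smooth_on U Y -> smooth_on U Z ->
  'D_v (fun y => 'D_(Y y) Z y) x =
  'D_('D_v Y x) Z x + 'D_v ('D_(Y x) Z) x.
Proof.
move=> oU Ux sY sZ.
have dZ := smooth_on_differentiable sZ Ux.
have dY := smooth_on_differentiable sY Ux.
pose b j : 'rV[R]_n := delta_mx ord0 j.
have dbZ j : differentiable ('D_(b j) Z) x.
  exact: smooth_on_differentiable (smooth_on_derive _ sZ) Ux.
have dYj j : differentiable (fun y => Y y ord0 j) x.
  exact: smooth_on_differentiable (smooth_on_coord_comp _ j oU sY) Ux.
have E1 : 'D_v (fun y => 'D_(Y y) Z y) x =
    'D_v (\sum_j (fun y => Y y ord0 j *: 'D_(b j) Z y)) x.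
  apply: near_eq_derive; apply: (open_near oU Ux) => y Uy.
  by rewrite derive_sumE ?fct_sumE //; exact: smooth_on_differentiable sZ Uy.
have E2 : 'D_v ('D_(Y x) Z) x = 'D_v (\sum_j (fun y => Y x ord0 j *: 'D_(b j) Z y)) x.
  apply: near_eq_derive; apply: (open_near oU Ux) => y Uy.
  by rewrite derive_sumE ?fct_sumE //; exact: smooth_on_differentiable sZ Uy.
have dc (a : 'rV[R]_n -> R) j : differentiable a x ->
    derivable (fun y => a y *: 'D_(b j) Z y) x v.
  by move=> da; apply: diff_derivable; case: (differentiable_scale da (dbZ j)).
rewrite E1 derive_sum; last by move=> j; exact: dc.
rewrite E2 derive_sum; last by move=> j; apply: dc; exact: differentiable_cst.
rewrite derive_sumE // -big_split /=; apply: eq_bigr => j _.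
have [_ ->] := differentiable_scale (dYj j) (dbZ j).
have [_ ->] := differentiable_scale (differentiable_cst (Y x ord0 j) x) (dbZ j).
by rewrite derive_cst scale0r addr0 addrC derive_coord.
Qed.

(** This is the vanishing curvature of the coordinate derivative: Schwarz's theorem exchanges the
    two frozen second derivatives left by [derive_derive_along]. *)
Lemma derive_along_commutator (U : set 'rV[R]_n) X Y Z x : open U -> U x ->
  smooth_on U X -> smooth_on U Y -> smooth_on U Z ->
  'D_(X x) (fun y => 'D_(Y y) Z y) x - 'D_(Y x) (fun y => 'D_(X y) Z y) x =
  'D_('D_(X x) Y x - 'D_(Y x) X x) Z x.
Proof.
move=> oU Ux sX sY sZ.
have dZ := smooth_on_differentiable sZ Ux.
have key (a b c d : 'rV[R]_m) : b = d -> a + b - (c + d) = a - c.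
  by move=> ->; rewrite opprD addrACA subrr addr0.
apply: (etrans (congr2 (fun a b => a - b)
  (derive_derive_along (X x) oU Ux sY sZ) (derive_derive_along (Y x) oU Ux sX sZ))).
apply: (etrans (key _ _ _ _ (Schwarz_row (X x) (Y x) oU Ux sZ))); apply: esym.
exact: etrans (deriveDv _ _ dZ) (congr1 _ (deriveNv _ dZ)).
Qed.

End SecondOrder.

(** * Orbit spaces and their atlas of local inverses *)

Section OrbitSpaceTopology.
Context {T : topologicalType} {G : transformation_group T}.
Local Notation proj := (orbit_proj G).

Lemma orbit_projP (x y : T) :
  proj x = proj y <-> exists2 g, tg_set G g & g x = y.
Proof.
rewrite (_ : (exists2 g, _ & _) <-> orbit_rel G x y); last exact: (rwP (asboolP _)).
split=> [H|H].
  exact/(@eqmodP _ (orbit_equiv G)).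
exact/(@eqmodP _ (orbit_equiv G)).
Qed.

Lemma orbit_proj_surj (p : orbit_space G) : exists x, proj x = p.
Proof. by exists (repr p); exact: reprK. Qed.

Lemma orbit_proj_continuous : continuous proj.
Proof. exact: pi_continuous. Qed.

(** The saturation of [U] is the union of its preimages under the group elements, each of them
    open. *)
Lemma orbit_proj_open (U : set T) :
  (forall g, tg_set G g -> continuous g) -> open U -> open (proj @` U).
Proof.
move=> Gc oU; rewrite /open /= /quotient_open.
rewrite (_ : _ @^-1` _ = \bigcup_(g in tg_set G) (g @^-1` U)).
  by apply: bigcup_open => g Gg; move/continuousP : (Gc g Gg); exact.
apply/seteqP; split=> x /=.
  move=> [y Uy /esym/orbit_projP[g Gg E]]; exists g => //=.
  by rewrite /= E.
by move=> [g Gg Ugx]; exists (g x) => //; apply/esym/orbit_projP; exists g.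
Qed.

(** A box around [(x, y)] that misses the closed orbit relation has sides with disjoint projections,
    and these are neighbourhoods because the projection is open. *)
Lemma orbit_space_hausdorff :
  (forall g, tg_set G g -> continuous g) ->
  closed [set xy : T * T | proj xy.1 = proj xy.2] ->
  hausdorff_space (orbit_space G).
Proof.
move=> Gc cR p q clpq.
have [x Ep] := orbit_proj_surj p; have [y Eq] := orbit_proj_surj q.
subst p q; apply: contrapT => xy.
have : nbhs (x, y) (~` [set xy : T * T | proj xy.1 = proj xy.2]).
  by apply: open_nbhs_nbhs; split => //; exact: closed_openC.
move=> [[A B] /= [nA nB] AB].
have proj_nbhs z C : nbhs z C -> nbhs (proj z) (proj @` C).
  rewrite nbhsE => -[D [oD Dz] DC]; rewrite nbhsE; exists (proj @` D).
    by split; [exact: orbit_proj_open|exists z].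
  by move=> _ [w /DC Cw <-]; exists w.
have [_ [[a Aa <-] [b Bb E]]] := clpq _ _ (proj_nbhs _ _ nA) (proj_nbhs _ _ nB).
exact: AB (a, b) (conj Aa Bb) (esym E).
Qed.

Lemma orbit_space_second_countable :
  (forall g, tg_set G g -> continuous g) ->
  @second_countable T -> @second_countable (orbit_space G).
Proof.
move=> Gc [B cB [oB bB]].
exists [set proj @` b | b in B]; first exact: card_le_trans (card_image_le _ _) cB.
split=> [_ [b /oB ob <-]|p]; first exact: orbit_proj_open.
have [x <-] := orbit_proj_surj p => A /orbit_proj_continuous /bB[b [Bb bx] bA].
by exists (proj @` b); [split; [exists b|exists x]|move=> _ [z /bA Az <-]].
Qed.

End OrbitSpaceTopology.

Section OrbitAtlasTheory.
Context {R : realType} {V : normedModType R} {G : transformation_group V}.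
Context (Gc : forall g, tg_set G g -> continuous g).
Local Notation proj := (orbit_proj G).
Local Notation A := (orbit_atlas G).
Implicit Types (i j : ix A).

Lemma cdom_open i : open (cdom i).
Proof. by case: i => U []. Qed.

Lemma par_inj i : {in cdom i &, injective proj}.
Proof. by case: i => U []. Qed.

Lemma crd_spec i p : patch_of i p -> cdom i (crd i p) /\ proj (crd i p) = p.
Proof.
move=> [x Ux px]; rewrite /crd /=.
by case: xgetP => [y -> []//|/(_ x)]; case.
Qed.

Lemma crdK i x : cdom i x -> crd i (proj x) = x.
Proof.
move=> Ux; have [] := @crd_spec i (proj x); first by exists x.
by move=> Uc; exact: par_inj (mem_set Uc) (mem_set Ux).
Qed.

Lemma patch_open i : open (patch_of i).
Proof. by apply: orbit_proj_open => //; exact: cdom_open. Qed.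

Lemma crd_continuous i p : patch_of i p -> {for p, continuous (crd i)}.
Proof.
move=> [x Ux <-] N; rewrite crdK // nbhsE => -[D [oD Dx] DN].
have : nbhs (proj x) (proj @` (D `&` cdom i)).
  apply: open_nbhs_nbhs; split; last by exists x.
  by apply: orbit_proj_open => //; apply: openI => //; exact: cdom_open.
by apply: filterS => _ [y [Dy Uy] <-]; exact: DN _ (eq_ind_r D Dy (crdK Uy)).
Qed.

(* Up to a group element, every chart inverts the projection. *)
Lemma crd_proj_near j x : patch_of j (proj x) ->
  exists g, [/\ tg_set G g, cdom j (g x) &
    \forall y \near x, cdom j (g y) /\ crd j (proj y) = g y].
Proof.
move=> /crd_spec[Ux /esym/orbit_projP[g Gg E]].
exists g; split=> //; first by rewrite E.
have oU : open (g @^-1` cdom j).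
  by move/continuousP : (Gc Gg); apply; exact: cdom_open.
apply: (open_near oU) => [|y Uy]; first by rewrite /= E.
split=> //; rewrite -[RHS](@crdK j) //; congr (crd j _).
by apply/orbit_projP; exists g.
Qed.

Lemma transition_near i j x : overlap i j x ->
  exists g, [/\ tg_set G g, cdom j (g x) &
    \forall y \near x, cdom j (g y) /\ transition i j y = g y].
Proof. by move=> [_ /crd_proj_near]. Qed.

Context (Gs : forall g, tg_set G g -> smooth_on setT g).

(** Stated on the full preimage of the patch, this serves the transition maps as well as the
    covering of the orbit space and its local inverses. *)
Lemma smooth_crd_proj j : smooth_on [set x | patch_of j (proj x)] (crd j \o proj).
Proof.
apply: smooth_on_near => x /= /crd_proj_near[g [Gg _ Eg]].
by exists setT, g; split=> //; [exact: Gs|apply: filterS Eg => y []].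
Qed.

Lemma orbit_smooth_manifold :
  @second_countable V ->
  closed [set xy : V * V | proj xy.1 = proj xy.2] ->
  (forall x, exists U : set V, [/\ open U, U x & {in U &, injective proj}]) ->
  smooth_manifold A.
Proof.
move=> sV cR locinj; split.
- by split; [exact: orbit_space_hausdorff|exact: orbit_space_second_countable].
- move=> p; have [x <-] := orbit_proj_surj p.
  have [U [oU Ux iU]] := locinj x.
  by exists (exist _ U (conj oU iU)); exists x.
- move=> i; split; [exact: cdom_open|exact: patch_open|].
  by move=> x /set_mem; exact: crdK.
- by move=> i; split=> [x _|p]; [exact: orbit_proj_continuous|exact: crd_continuous].
- move=> i j; apply: smooth_on_sub (smooth_crd_proj j) => x [] //.
Qed.

End OrbitAtlasTheory.

(** * Fields, frames and connections *)

Section FieldAlgebra.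
Context {R : realType} {V : normedModType R} {M : topologicalType}.
Context {A : atlas V M} (mfA : smooth_manifold A).
Implicit Types (X Y : field A) (i j : ix A).

Lemma chart_open i : open (cdom i).
Proof. by have [_ _ /(_ i)[]] := mfA. Qed.

Lemma chart_cancel i x : cdom i x -> crd i (par i x) = x.
Proof. by have [_ _ /(_ i)[_ _ K] _ _] := mfA => /mem_set/K. Qed.

Lemma par_crd i p : patch_of i p -> cdom i (crd i p) /\ par i (crd i p) = p.
Proof. by move=> [x Ux <-]; rewrite chart_cancel. Qed.

Lemma transition_overlap i j x : overlap i j x ->
  cdom j (transition i j x) /\ par j (transition i j x) = par i x.
Proof. by move=> [_ /par_crd]. Qed.

Lemma transition_differentiable i j x :
  overlap i j x -> differentiable (transition i j) x.
Proof.
have [_ _ _ _ sm] := mfA.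
exact: smooth_on_differentiable (sm i j).
Qed.

Lemma smooth_fun_cst (c : R) : smooth_fun A (fun=> c).
Proof. by move=> i; exact: smooth_on_cst. Qed.

Lemma is_field_zerof : is_field (zerof A).
Proof.
split=> [i|//|i j x ov]; first exact: smooth_on_cst.
by rewrite derive0.
Qed.

Lemma is_field_addf X Y : is_field X -> is_field Y -> is_field (addf X Y).
Proof.
move=> [sX zX tX] [sY zY tY]; split=> [i|i x nx|i j x ov].
- exact: smooth_on_add (chart_open i) (sX i) (sY i).
- by rewrite /addf zX // zY // addr0.
- rewrite /addf tX // tY //.
  exact: esym (deriveDv _ _ (transition_differentiable ov)).
Qed.

Lemma is_field_mulf f X : smooth_fun A f -> is_field X -> is_field (mulf f X).
Proof.
move=> sf [sX zX tX]; split=> [i|i x nx|i j x ov].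
- exact: smooth_on_scale (chart_open i) (sf i) (sX i).
- by rewrite /mulf zX // scaler0.
- rewrite /mulf tX // (transition_overlap ov).2.
  exact: esym (deriveZv _ _ (transition_differentiable ov)).
Qed.

Lemma subf_addf X Y : subf X Y = addf X (mulf (fun=> -1) Y).
Proof.
by apply/funext => i; apply/funext => x; rewrite /subf /addf /mulf scaleN1r.
Qed.

Lemma is_field_subf X Y : is_field X -> is_field Y -> is_field (subf X Y).
Proof.
move=> fX fY; rewrite subf_addf; apply: is_field_addf => //.
by apply: is_field_mulf => //; exact: smooth_fun_cst.
Qed.

Lemma mulf0 X : mulf (fun=> 0) X = zerof A.
Proof. by apply/funext => i; apply/funext => x; rewrite /mulf scale0r. Qed.

Lemma addf0 X : addf X (zerof A) = X.
Proof. by apply/funext => i; apply/funext => x; rewrite /addf addr0. Qed.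

Context (nabla : field A -> field A -> field A) (cn : is_connection nabla).

Lemma connection_zerol Y : is_field Y -> nabla (zerof A) Y = zerof A.
Proof.
move=> fY; have [_ _ ml _ _] := cn.
rewrite -[in LHS](mulf0 (zerof A)) ml ?mulf0 //; first exact: smooth_fun_cst.
exact: is_field_zerof.
Qed.

Lemma connection_zeror X : is_field X -> nabla X (zerof A) = zerof A.
Proof.
move=> fX; have [_ _ _ _ L] := cn.
rewrite -[in LHS](mulf0 (zerof A)) L //.
- rewrite mulf0 addf0; apply/funext => i; apply/funext => x.
  by rewrite /derivf scaler0.
- exact: smooth_fun_cst.
- exact: is_field_zerof.
Qed.

End FieldAlgebra.

Section Frames.
Context {R : realType} {n : nat} {M : topologicalType}.
Context {A : atlas 'rV[R]_n M} (mfA : smooth_manifold A).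
Implicit Types (X Y : field A) (i j : ix A).

Lemma smooth_on_oneform (a : oneform A) X i : is_oneform a -> is_field X ->
  smooth_on (cdom i) (fun x => a i x (X i x)).
Proof.
move=> [la sa _ _] [sX _ _]; have oU := chart_open mfA i.
have la' x : a i x (X i x) = \sum_k X i x ord0 k *: a i x (delta_mx ord0 k).
  pose b := GRing.isLinear.Build _ _ _ _ (a i x) (la i x).
  pose L : {scalar 'rV[R]_n} := HB.pack (a i x) b.
  rewrite [in LHS](row_sum_delta (X i x)) -[a i x]/(L : _ -> R) linear_sum.
  by apply: eq_bigr => k _; rewrite linearZ.
apply: (smooth_on_eq oU (fun x _ => la' x)).
apply: smooth_on_sum => // k; apply: smooth_on_scale => //.
exact: smooth_on_coord_comp.
Qed.

(** A chart is chosen at every point of M; the transformation laws of [a] and [X] make the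
    contraction independent of that choice. *)
Lemma contraction_fun (a : oneform A) X : is_oneform a -> is_field X ->
  exists2 f, smooth_fun A f & forall i x, cdom i x -> f (par i x) = a i x (X i x).
Proof.
move=> fa fX; have [_ cover _ _ _] := mfA.
pose c p := sval (cid (cover p)).
pose f p := a (c p) (crd (c p) p) (X (c p) (crd (c p) p)).
have fE i x : cdom i x -> f (par i x) = a i x (X i x).
  move=> Ux; rewrite /f; set j := c _.
  have ov : overlap i j x by split=> //; exact: svalP (cid (cover (par i x))).
  have [_ _ _ ta] := fa; have [_ _ tX] := fX.
  by rewrite -[crd j _]/(transition i j x) tX // ta.
exists f => // i.
exact: smooth_on_eq (chart_open mfA i) (fE i) (smooth_on_oneform i fa fX).
Qed.

Context {m : nat} (F : 'I_m -> field A) (a : 'I_m -> oneform A).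
Context (fF : forall k, is_field (F k)) (fa : forall k, is_oneform (a k)).
Context (frame : forall i x v, cdom i x -> v = \sum_k a k i x v *: F k i x).

(** The coefficients are global smooth functions by [contraction_fun], so every field is a finite
    sum of function multiples of the frame fields. *)
Lemma frame_ind (P : field A -> Prop) : P (zerof A) ->
  (forall X Y, is_field X -> is_field Y -> P X -> P Y -> P (addf X Y)) ->
  (forall f k, smooth_fun A f -> P (mulf f (F k))) ->
  forall X, is_field X -> P X.
Proof.
move=> P0 PD PM X fX.
have /choice[f sf] : forall k, exists f, smooth_fun A f /\
    forall i x, cdom i x -> f (par i x) = a k i x (X i x).
  by move=> k; have [f sf fE] := contraction_fun (fa k) fX; exists f.
pose S (r : seq 'I_m) := foldr (fun k Y => addf (mulf (f k) (F k)) Y) (zerof A) r.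
have SP r : is_field (S r) /\ P (S r).
  elim: r => [|k r [fS PS]] /=; first by split; [exact: is_field_zerof|].
  have fk : is_field (mulf (f k) (F k)) := is_field_mulf mfA (sf k).1 (fF k).
  split; first refine (is_field_addf mfA fk fS).
  exact: PD _ _ fk fS (PM _ _ (sf k).1) PS.
suff -> : X = S (index_enum 'I_m) by case: (SP (index_enum 'I_m)).
have SE r i x : S r i x = \sum_(k <- r) f k (par i x) *: F k i x.
  elim: r => [|k r IH]; first by rewrite big_nil.
  by rewrite big_cons -IH.
apply/funext => i; apply/funext => x; rewrite SE.
(* The frame expansion holds inside the chart domain; outside it both sides are 0 by the extension
   convention. *)
have [Ux|nUx] := pselect (cdom i x).
  rewrite [LHS](frame (X i x) Ux); apply: eq_bigr => k _.
  by rewrite (sf k).2.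
have [_ zX _] := fX; rewrite zX // big1 // => k _.
by have [_ z _] := fF k; rewrite z // scaler0.
Qed.

(** Frame induction is applied to [X], using linearity over functions, and then to [Y], where the
    derivative term of the Leibniz rule is common to both connections. *)
Lemma connection_unique (nabla nabla' : field A -> field A -> field A) :
  is_connection nabla -> is_connection nabla' ->
  (forall k l, nabla (F k) (F l) = nabla' (F k) (F l)) ->
  forall X Y, is_field X -> is_field Y -> nabla X Y = nabla' X Y.
Proof.
move=> cn cn' E X Y fX fY.
have [n1 n2 n3 n4 n5] := cn; have [n1' n2' n3' n4' n5'] := cn'.
move: X fX; apply: frame_ind.
- exact: etrans (connection_zerol cn fY) (esym (connection_zerol cn' fY)).
- move=> X X' fX fX' EX EX'.
  by rewrite (n2 _ _ _ fX fX' fY) (n2' _ _ _ fX fX' fY) EX EX'.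
move=> f k sf; rewrite (n3 _ _ _ sf (fF k) fY) (n3' _ _ _ sf (fF k) fY).
congr mulf; have fX := fF k.
move: Y fY; apply: frame_ind.
- exact: etrans (connection_zeror cn fX) (esym (connection_zeror cn' fX)).
- move=> Y Y' fY fY' EY EY'.
  by rewrite (n4 _ _ _ fX fY fY') (n4' _ _ _ fX fY fY') EY EY'.
by move=> g l sg; rewrite (n5 _ _ _ sg fX (fF l)) (n5' _ _ _ sg fX (fF l)) E.
Qed.

End Frames.

(** * Descent of invariant tensors to the orbit space *)

Section Descent.
Context {R : realType} {V : normedModType R} {G : transformation_group V}.
Context (Gc : forall g, tg_set G g -> continuous g).
Local Notation A := (orbit_atlas G).
Implicit Types (i j : ix A).

Lemma descend_fieldE (X : V -> V) i x : cdom i x -> descend_field G X i x = X x.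
Proof. by move=> Ux; rewrite /descend_field patchT //; exact/mem_set. Qed.

Lemma descend_field0 (X : V -> V) i x : ~ cdom i x -> descend_field G X i x = 0.
Proof. by move=> Ux; rewrite /descend_field /patch memNset. Qed.

Lemma descend_oneformE a i x v : cdom i x -> descend_oneform G a i x v = a x v.
Proof. by move=> Ux; rewrite /descend_oneform patchT //; exact/mem_set. Qed.

Lemma descend_oneform0 a i x v : ~ cdom i x -> descend_oneform G a i x v = 0.
Proof. by move=> Ux; rewrite /descend_oneform /patch memNset. Qed.

Lemma descend_twoformE w i x u v :
  cdom i x -> descend_twoform G w i x u v = w x u v.
Proof. by move=> Ux; rewrite /descend_twoform patchT //; exact/mem_set. Qed.

Lemma descend_twoform0 w i x u v :
  ~ cdom i x -> descend_twoform G w i x u v = 0.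
Proof. by move=> Ux; rewrite /descend_twoform /patch memNset. Qed.

(** Since a transition map is locally a group element, the transformation law of a tensor turns into
    its invariance under the group. *)
Lemma transition_derive i j x : overlap i j x ->
  exists g, [/\ tg_set G g, cdom j (g x), transition i j x = g x &
    forall v, 'D_v (transition i j) x = 'D_v g x].
Proof.
move=> /(transition_near Gc)[g [Gg Ug Eg]]; exists g; split=> //.
  by have [] := nbhs_singleton Eg.
by move=> v; apply: near_eq_derive; apply: filterS Eg => y [].
Qed.

Lemma is_field_descend X : smooth_on setT X -> invariant_field G X ->
  is_field (descend_field G X).
Proof.
move=> sX iX; split=> [i|i x|i j x ov].
- apply: (smooth_on_eq (cdom_open i) (fun x => @descend_fieldE X i x)).
  by apply: smooth_on_sub sX.
- exact: descend_field0.
have [g [Gg Ug -> ->]] := transition_derive ov.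
by rewrite !descend_fieldE ?iX //; case: ov.
Qed.

Lemma is_oneform_descend (a : V -> V -> R) : (forall x, scalar (a x)) ->
  (forall v, smooth_on setT (fun x => a x v)) -> invariant_oneform G a ->
  is_oneform (descend_oneform G a).
Proof.
move=> la sa ia; split=> [i x|i v|i x v|i j x v ov].
- have [Ux|nUx] := pselect (cdom i x).
    by move=> k u v; rewrite !descend_oneformE //; exact: la.
  by move=> k u v; rewrite !descend_oneform0 // mulr0 addr0.
- apply: (smooth_on_eq (cdom_open i) (fun x => @descend_oneformE a i x v)).
  by apply: smooth_on_sub (sa v).
- exact: descend_oneform0.
have [g [Gg Ug -> ->]] := transition_derive ov.
by rewrite !descend_oneformE ?ia //; case: ov.
Qed.

Lemma is_twoform_descend (w : V -> V -> V -> R) :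
  (forall x v, [/\ scalar (w x v), scalar (w x ^~ v) & w x v v = 0]) ->
  (forall u v, smooth_on setT (fun x => w x u v)) ->
  (forall g, tg_set G g -> forall x u v, w (g x) ('D_u g x) ('D_v g x) = w x u v) ->
  is_twoform (descend_twoform G w).
Proof.
move=> lw sw iw; split=> [i x v|i u v|i x u v|i j x u v ov].
- have [Ux|nUx] := pselect (cdom i x).
    have [l1 l2 l3] := lw x v.
    by split=> [k u u'|k u u'|]; rewrite !descend_twoformE //; [exact: l1|exact: l2].
  by split=> [k u u'|k u u'|]; rewrite !descend_twoform0 // mulr0 addr0.
- apply: (smooth_on_eq (cdom_open i) (fun x => @descend_twoformE w i x u v)).
  by apply: smooth_on_sub (sw u v).
- exact: descend_twoform0.
have [g [Gg Ug -> E]] := transition_derive ov.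
by rewrite !E !descend_twoformE ?iw //; case: ov.
Qed.

End Descent.

(** * Connections with constant Christoffel symbols *)

Lemma linear_prop0 {R : realType} (V W : lmodType R) (f : V -> W) :
  linear f -> f 0 = 0.
Proof.
by move=> fl; have := fl (-1) 0 0; rewrite scaler0 add0r scaleN1r addNr.
Qed.

Section BilinearCalculus.
Context {R : realType} {n : nat} {W : normedModType R}.
Local Notation V := 'rV[R]_n.
Context {B : V -> V -> W} (Bl : forall v, linear (B ^~ v)) (Br : forall u, linear (B u)).

Lemma bilin_expand u v : B u v =
  \sum_j \sum_k (u ord0 j * v ord0 k) *: B (delta_mx ord0 j) (delta_mx ord0 k).
Proof.
have El (w : V) : B u w = \sum_j u ord0 j *: B (delta_mx ord0 j) w.
  pose b := GRing.isLinear.Build _ _ _ _ (B ^~ w) (Bl w).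
  pose L : {linear V -> W} := HB.pack (B ^~ w) b.
  rewrite [in LHS](row_sum_delta u) -[LHS]/(L _) linear_sum.
  by apply: eq_bigr => k _; rewrite linearZ.
have Er (w : V) : B w v = \sum_k v ord0 k *: B w (delta_mx ord0 k).
  pose b := GRing.isLinear.Build _ _ _ _ (B w) (Br w).
  pose L : {linear V -> W} := HB.pack (B w) b.
  rewrite [in LHS](row_sum_delta v) -[LHS]/(L _) linear_sum.
  by apply: eq_bigr => k _; rewrite linearZ.
rewrite El; apply: eq_bigr => j _; rewrite Er scaler_sumr.
by apply: eq_bigr => k _; rewrite scalerA.
Qed.

Lemma smooth_on_bilin (V0 : normedModType R) (U : set V0) (X Y : V0 -> V) :
  open U -> smooth_on U X -> smooth_on U Y -> smooth_on U (fun x => B (X x) (Y x)).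
Proof.
move=> oU sX sY; apply: (smooth_on_eq oU (fun x _ => bilin_expand (X x) (Y x))).
apply: smooth_on_sum => // j; apply: smooth_on_sum => // k.
apply: smooth_on_scale => //; last exact: smooth_on_cst.
by apply: smooth_on_mul => //; exact: smooth_on_coord_comp.
Qed.

Lemma bilin_continuous : continuous (fun p : V * V => B p.1 p.2).
Proof.
(* Continuity is the order 0 of smoothness, applied to the two projections. *)
move=> p; apply: (@smooth_on_bilin _ setT fst snd _ _ _ 0%N) => //.
- exact: openT.
- by apply: (@smooth_on_linear _ _ _ _ fst) => q; exact: cvg_fst.
- by apply: (@smooth_on_linear _ _ _ _ snd) => q; exact: cvg_snd.
Qed.

Lemma derive_bilin (V0 : normedModType R) (X Y : V0 -> V) x w :
  differentiable X x -> differentiable Y x ->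
  differentiable (fun y => B (X y) (Y y)) x /\
  'D_w (fun y => B (X y) (Y y)) x = B (X x) ('D_w Y x) + B ('D_w X x) (Y x).
Proof.
move=> dX dY.
have bB : bilinear_for *:%R *:%R B by split=> [v|u]; [exact: Bl|exact: Br].
pose b := bilinear_isBilinear.Build R V V W _ _ B bB.
pose Bb : {bilinear V -> V -> W} := HB.pack B b.
have Bc : continuous (fun p : V * V => Bb p.1 p.2) := bilin_continuous.
have dp := differentiable_pair dX dY.
have dB := differentiable_bilin (X x, Y x) Bc.
have dc := differentiable_comp dp dB.
split; first exact: dc.
rewrite -[LHS]/('D_w ((fun p : V * V => Bb p.1 p.2) \o (fun y => (X y, Y y))) x).
rewrite (deriveE _ dc) diff_comp // (diff_bilin _ Bc) diff_pair //=.
by congr (B _ _ + B _ _); apply: esym; apply: deriveE.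
Qed.

End BilinearCalculus.

Lemma derive_affine {R : realType} (V W : normedModType R) (f : V -> W) x v w :
  (forall h, f (h *: v + x) = f x + h *: w) -> 'D_v f x = w.
Proof.
move=> E; rewrite /derive; apply: lim_near_cst => //; near=> h.
have h0 : h != 0 by near: h; exact: nbhs_dnbhs_neq.
by rewrite /= E addrAC subrr add0r scalerA mulVf // scale1r.
Unshelve. all: by end_near. Qed.

Lemma derive_comp {R : realType} (V W W' : normedModType R) (f : V -> W)
    (g : W -> W') x v : differentiable f x -> differentiable g (f x) ->
  'D_v (g \o f) x = 'D_('D_v f x) g (f x).
Proof.
move=> df dg; rewrite (deriveE _ (differentiable_comp df dg)).
have /(congr1 (fun h : V -> W' => h v)) /= -> := diff_comp df dg.
have -> : 'd f x v = 'D_v f x by apply: esym; exact: deriveE.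
by apply: esym; exact: deriveE.
Qed.

Section ConstantConnection.
Context {R : realType} {n : nat} {G : transformation_group 'rV[R]_n}.
Local Notation V := 'rV[R]_n.
Local Notation A := (orbit_atlas G).
Implicit Types (X Y Z : field A) (i j : ix A).

Definition const_connection (C : V -> V -> V) : field A -> field A -> field A :=
  fun X Y i x => 'D_(X i x) (Y i) x + C (X i x) (Y i x).

(** Under an affine change of coordinates Christoffel symbols transform as a tensor, so this is the
    condition for constant symbols [C] to descend. *)
Definition affine_preserves (C : V -> V -> V) (g : V -> V) :=
  exists (L : 'M[R]_n) (b : V), (forall t, g t = t *m L + b) /\
    (forall u v, C (u *m L) (v *m L) = C u v *m L).

Context (mfA : smooth_manifold A) (Gc : forall g, tg_set G g -> continuous g).

Lemma mulmxr_continuous m (L : 'M[R]_(n, m)) : continuous (fun u : V => u *m L).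
Proof.
move=> x; apply: (@smooth_on_row _ _ _ setT _ _ _ 0%N) => // [|j]; first exact: openT.
apply: (@smooth_on_eq _ _ _ _ _ (fun u : V => \sum_k u ord0 k * L k j)).
- exact: openT.
- by move=> u _; rewrite mxE.
apply: smooth_on_sum => [|k]; first exact: openT.
apply: smooth_on_mul => //; first exact: openT.
  exact: smooth_on_coord.
exact: smooth_on_cst.
Qed.

(** An affine transition has no second derivatives, so the coordinate derivative of [Y] and the term
    in [C] each obey the law of a vector field. *)
Lemma is_field_const_connection C X Y :
  (forall v, linear (C ^~ v)) -> (forall u, linear (C u)) ->
  (forall g, tg_set G g -> affine_preserves C g) ->
  is_field X -> is_field Y -> is_field (const_connection C X Y).
Proof.
move=> Cl Cr CG [sX zX tX] [sY zY tY]; split=> [i|i x nx|i j x ov].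
- have oU := chart_open mfA i; apply: smooth_on_add => //.
    exact: smooth_on_derive_along.
  exact: smooth_on_bilin.
- rewrite /const_connection zX // derive0 add0r.
  exact: linear_prop0 (Cl (Y i x)).
have [g [Gg Ug Tg]] := transition_near Gc ov.
have [L [b [gE CL]]] := CG g Gg.
have Dg y v : 'D_v g y = v *m L.
  by apply: derive_affine => h; rewrite !gE mulmxDl -scalemxAl -addrA addrC.
have Tx : transition i j x = g x by case: (nbhs_singleton Tg).
have TD v : 'D_v (transition i j) x = v *m L.
  rewrite -(Dg x); apply: near_eq_derive; apply: filterS Tg => y [] //.
have [Ux _] := ov.
have dYi : differentiable (Y i) x := smooth_on_differentiable (sY i) Ux.
have dYj : differentiable (Y j) (g x) := smooth_on_differentiable (sY j) Ug.
(* The law for [Y] is required on a neighbourhood and not just at [x], because it is differentiated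
   below. *)
have Yg : \forall y \near x, Y j (g y) = Y i y *m L.
  have Un : \forall y \near x, cdom i y.
    by apply: (open_near (chart_open mfA i) Ux).
  apply: filterS2 Un (nbhs_interior Tg) => y Uiy Ty.
  have [Ugy <-] := nbhs_singleton Ty.
  rewrite tY; last first.
    split=> //; exists (g y) => //.
    have [_ E] := nbhs_singleton Ty.
    apply/orbit_projP.
    have [h Gh hK] : exists2 h, tg_set G h & h (g y) = y.
      by have [_ _ /(_ g Gg)[h Gh [gK _]]] := tgP G; exists h.
    by exists h.
  rewrite -(Dg y); apply: near_eq_derive.
  by apply: filterS Ty => z [].
have XT : X j (g x) = X i x *m L by rewrite -Tx tX // TD.
rewrite (TD (const_connection C X Y i x)) Tx /const_connection XT.
rewrite (nbhs_singleton Yg) CL mulmxDl; congr (_ + _).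
have dg : differentiable g x.
  have -> : g = (fun t => t *m L + b) by apply/funext.
  apply: (@differentiableD _ _ _ (mulmxr L) (cst b)); last exact: differentiable_cst.
  by apply: linear_differentiable; exact: mulmxr_continuous.
have -> : 'D_(X i x *m L) (Y j) (g x) = 'D_(X i x) (Y j \o g) x.
  exact: etrans (congr1 (fun w => 'D_w (Y j) (g x)) (esym (Dg x (X i x))))
    (esym (derive_comp (X i x) dg dYj)).
have -> : 'D_(X i x) (Y j \o g) x = 'D_(X i x) (mulmxr L \o Y i) x.
  exact: near_eq_derive.
apply: (@derive_linear_comp _ _ _ _ (mulmxr L) (Y i)) => //.
exact: mulmxr_continuous.
Qed.

Context (C : V -> V -> V).
Context (Cl : forall v, linear (C ^~ v)) (Cr : forall u, linear (C u)).
Context (CG : forall g, tg_set G g -> affine_preserves C g).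
Local Notation nabla := (const_connection C).

Let C0l v : C 0 v = 0.
Proof. exact: linear_prop0 (Cl v). Qed.
Let C0r u : C u 0 = 0.
Proof. exact: linear_prop0 (Cr u). Qed.
Let CDl u u' v : C (u + u') v = C u v + C u' v.
Proof. by have := Cl v 1 u u'; rewrite !scale1r. Qed.
Let CDr u v v' : C u (v + v') = C u v + C u v'.
Proof. by have := Cr u 1 v v'; rewrite !scale1r. Qed.
Let CZl a u v : C (a *: u) v = a *: C u v.
Proof. by have := Cl v a u 0; rewrite !addr0 C0l addr0. Qed.
Let CZr a u v : C u (a *: v) = a *: C u v.
Proof. by have := Cr u a v 0; rewrite !addr0 C0r addr0. Qed.
Let CNl u v : C (- u) v = - C u v.
Proof. by rewrite -scaleN1r CZl scaleN1r. Qed.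
Let CNr u v : C u (- v) = - C u v.
Proof. by rewrite -scaleN1r CZr scaleN1r. Qed.

Lemma const_connection_is_connection : is_connection nabla.
Proof.
split=> [X Y|X X' Y fX fX' fY|f X Y sf fX fY|X Y Y' fX fY fY'|f X Y sf fX fY].
- exact: is_field_const_connection.
- apply/funext => i; apply/funext => x; rewrite /const_connection /addf CDl.
  rewrite addrACA; congr (_ + _).
  have [Ux|nUx] := pselect (cdom i x).
    by apply: deriveDv; have [sY _ _] := fY; exact: smooth_on_differentiable (sY i) Ux.
  have [_ zX _] := fX; have [_ zX' _] := fX'.
  by rewrite zX // zX' // addr0 derive0 addr0.
- apply/funext => i; apply/funext => x; rewrite /const_connection /mulf CZl.
  rewrite scalerDr; congr (_ + _).
  have [Ux|nUx] := pselect (cdom i x).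
    by apply: deriveZv; have [sY _ _] := fY; exact: smooth_on_differentiable (sY i) Ux.
  by have [_ zX _] := fX; rewrite zX // scaler0 derive0 scaler0.
- apply/funext => i; apply/funext => x; rewrite /const_connection /addf CDr.
  rewrite addrACA; congr (_ + _).
  have [Ux|nUx] := pselect (cdom i x).
    have [sY _ _] := fY; have [sY' _ _] := fY'.
    by apply: deriveD; [exact: smooth_on_derivable (sY i) Ux|exact: smooth_on_derivable (sY' i) Ux].
  by have [_ zX _] := fX; rewrite zX // !derive0 addr0.
apply/funext => i; apply/funext => x.
rewrite /const_connection /addf /mulf /derivf CZr scalerDr addrA; congr (_ + _).
have [Ux|nUx] := pselect (cdom i x).
  have [sY _ _] := fY.
  have [_ ->] := differentiable_scale (smooth_on_differentiable (sf i) Ux)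
                                      (smooth_on_differentiable (sY i) Ux).
  by rewrite addrC.
by have [_ zX _] := fX; rewrite zX // !derive0 scaler0 scale0r addr0.
Qed.

(** The bracket is the antisymmetrised connection with zero Christoffel symbols, which every affine
    map preserves. *)
Lemma is_field_bracket X Y : is_field X -> is_field Y -> is_field (bracket X Y).
Proof.
move=> fX fY.
pose D := const_connection (fun _ _ => 0).
have -> : bracket X Y = subf (D X Y) (D Y X).
  by apply/funext => i; apply/funext => x; rewrite /subf /D /const_connection !addr0.
have l0 : linear (fun _ : V => 0 : V) by move=> a u v; rewrite scaler0 addr0.
have fD X' Y' : is_field X' -> is_field Y' -> is_field (D X' Y').
  apply: is_field_const_connection => // g Gg.
  have [L [b [gE _]]] := CG Gg; exists L, b; split=> // u v.
  by rewrite mul0mx.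
refine (is_field_subf mfA (fD _ _ fX fY) (fD _ _ fY fX)).
Qed.

Lemma const_connection_torsion_free : (forall u v, C u v = C v u) -> torsion_free nabla.
Proof.
move=> Csym X Y fX fY; apply/funext => i; apply/funext => x.
rewrite /torsion /subf /const_connection /bracket (Csym (Y i x)) /zerof.
by rewrite opprD addrACA subrr addr0 subrr.
Qed.

Let derive_nabla Y Z i x w : is_field Y -> is_field Z -> cdom i x ->
  'D_w (nabla Y Z i) x = 'D_w (fun y => 'D_(Y i y) (Z i) y) x +
    (C (Y i x) ('D_w (Z i) x) + C ('D_w (Y i) x) (Z i x)).
Proof.
move=> [sY _ _] [sZ _ _] Ux; have oU := chart_open mfA i.
have dY := smooth_on_differentiable (sY i) Ux.
have dZ := smooth_on_differentiable (sZ i) Ux.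
have [dC <-] := derive_bilin Cl Cr w dY dZ.
apply: deriveD; last exact: diff_derivable.
exact: smooth_on_derivable (smooth_on_derive_along oU (sY i) (sZ i)) Ux.
Qed.

(** For constant [C] the curvature is the commutator of the endomorphisms [C u] and [C v]: the terms
    with one derivative cancel by the product rule, those with two by [derive_along_commutator]. *)
Lemma const_connection_flat :
  (forall u v w, C (C u v) w = 0) -> (forall u v w, C u (C v w) = 0) ->
  flat nabla.
Proof.
move=> CCl CCr X Y Z fX fY fZ; apply/funext => i; apply/funext => x.
rewrite /curvature /subf /zerof.
have [sX zX _] := fX; have [sY zY _] := fY; have [sZ zZ _] := fZ.
(* Outside the chart domain no smoothness is available; each of the three terms vanishes there
   because it is again a field. *)
have [Ux|nUx] := pselect (cdom i x); last first.
  have fN := is_field_const_connection Cl Cr CG.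
  have [_ z1 _] := fN _ _ fX (fN _ _ fY fZ).
  have [_ z2 _] := fN _ _ fY (fN _ _ fX fZ).
  have [_ z3 _] := fN _ _ (is_field_bracket fX fY) fZ.
  by rewrite (z1 i x nUx) (z2 i x nUx) (z3 i x nUx) !subr0.
have oU := chart_open mfA i.
have H := derive_along_commutator oU Ux (sX i) (sY i) (sZ i).
rewrite {1}/const_connection (derive_nabla _ fY fZ Ux).
rewrite {2}/const_connection (derive_nabla _ fX fZ Ux).
rewrite {3}/const_connection.
rewrite {1 2}/const_connection !CDr !CCr !addr0 -[bracket X Y i x]/('D_(X i x) (Y i) x - 'D_(Y i x) (X i) x).
rewrite -H CDl CNl.
move: ('D_(X i x) (fun y => _) x) ('D_(Y i x) (fun y => _) x) => a b.
move: (C (Y i x) _) (C _ (Z i x)) (C (X i x) _) (C _ (Z i x)) => p q r s.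
rewrite !opprD opprK.
by apply/rowP => k; rewrite !mxE; ring.
Qed.

(** As [om] is constant, only the action of the endomorphism [C u] on [om] survives; the last
    hypothesis says that [C u] lies in the Lie algebra preserving [om]. *)
Lemma const_connection_parallel (w : twoform A) (om : V -> V -> R) :
  (forall i x u v, cdom i x -> w i x u v = om u v) ->
  (forall v, scalar (om ^~ v)) -> (forall u, scalar (om u)) ->
  (forall u v z, om (C u v) z + om v (C u z) = 0) -> parallel nabla w.
Proof.
move=> wE ol or oC X Y Z [sX _ _] [sY _ _] [sZ _ _] i x Ux; rewrite /cov_deriv.
have oU := chart_open mfA i.
have dY := smooth_on_differentiable (sY i) Ux.
have dZ := smooth_on_differentiable (sZ i) Ux.
have [_ D] := derive_bilin ol or (X i x) dY dZ.
have -> : 'D_(X i x) (fun y => w i y (Y i y) (Z i y)) x =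
          'D_(X i x) (fun y => om (Y i y) (Z i y)) x.
  by apply: near_eq_derive; apply: (open_near oU Ux) => y Uy; rewrite wE.
rewrite D !wE // /const_connection.
have oDl u u' v : om (u + u') v = om u v + om u' v.
  by have := ol v 1 u u'; rewrite scale1r mul1r.
have oDr u v v' : om u (v + v') = om u v + om u v'.
  by have := or u 1 v v'; rewrite scale1r mul1r.
rewrite oDl oDr; have := oC (X i x) (Y i x) (Z i x); lra.
Qed.

(* Along an affine field with linear part [N], Schwarz's theorem reduces
   L_X nabla to the action of [N] on the constant tensor [C]. *)
Lemma const_connection_lie X (N : V -> V) : is_field X ->
  (forall i x v, cdom i x -> 'D_v (X i) x = N v) ->
  (forall u v, C (N u) v + C u (N v) = N (C u v)) ->
  infinitesimal_automorphism nabla X.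
Proof.
move=> fX XN NC Y Z fY fZ; apply/funext => i; apply/funext => x.
rewrite /lie_connection /subf /zerof.
have [sX zX _] := fX; have [sY zY _] := fY; have [sZ zZ _] := fZ.
have fb W : is_field W -> is_field (bracket X W) by exact: is_field_bracket.
have [Ux|nUx] := pselect (cdom i x); last first.
  have [_ z1 _] := is_field_const_connection Cl Cr CG fY fZ.
  have [_ z2 _] := is_field_const_connection Cl Cr CG (fb _ fY) fZ.
  have [_ z3 _] := is_field_const_connection Cl Cr CG fY (fb _ fZ).
  by rewrite {1}/bracket zX // z1 // z2 // z3 // !derive0 !subr0.
have oU := chart_open mfA i.
have bE W y : cdom i y -> bracket X W i y = 'D_(X i y) (W i) y - N (W i y).
  by move=> Uy; rewrite /bracket XN.
have dX := smooth_on_differentiable (sX i) Ux.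
(* [N] is given as a bare function; additivity, homogeneity and later continuity are read off the
   differential of [X] at [x]. *)
have ND u v : N (u + v) = N u + N v.
  by rewrite -!(XN i x) // deriveDv.
have Nl : linear N.
  by move=> a u v; rewrite ND; congr (_ + _); rewrite -!(XN i x) // deriveZv.
have H := derive_along_commutator oU Ux (sX i) (sY i) (sZ i).
have E1 : bracket X (nabla Y Z) i x =
  ('D_(X i x) (fun y => 'D_(Y i y) (Z i) y) x +
    (C (Y i x) ('D_(X i x) (Z i) x) + C ('D_(X i x) (Y i) x) (Z i x))) -
  N ('D_(Y i x) (Z i) x + C (Y i x) (Z i x)).
  by rewrite bE // derive_nabla.
have E2 : nabla (bracket X Y) Z i x =
    ('D_(X i x) (fun y => 'D_(Y i y) (Z i) y) x -
     'D_(Y i x) (fun y => 'D_(X i y) (Z i) y) x) +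
    C ('D_(X i x) (Y i) x - N (Y i x)) (Z i x).
  refine (congr2 (fun a b : V => a + b) (esym H) (congr1 (C^~ (Z i x)) (bE Y x Ux))).
have E3 : nabla Y (bracket X Z) i x =
    'D_(Y i x) (fun y => 'D_(X i y) (Z i) y) x - N ('D_(Y i x) (Z i) x) +
    C (Y i x) ('D_(X i x) (Z i) x - N (Z i x)).
  refine (congr2 (fun a b : V => a + b) _ (congr1 (C (Y i x)) (bE Z x Ux))).
  pose b := GRing.isLinear.Build _ _ _ _ N Nl.
  pose NN : {linear V -> V} := HB.pack N b.
  have Nc : continuous NN.
    have -> : (NN : V -> V) = 'd (X i) x.
      by apply/funext => v; rewrite -deriveE // XN.
    exact: diff_continuous.
  have dZ := smooth_on_differentiable (sZ i) Ux.
  have <- : 'D_(Y i x) (NN \o Z i) x = N ('D_(Y i x) (Z i) x).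
    exact: derive_linear_comp.
  transitivity ('D_(Y i x) ((fun y => 'D_(X i y) (Z i) y) - (NN \o Z i)) x).
    by apply: near_eq_derive; apply: (open_near oU Ux) => y Uy; rewrite bE.
  apply: deriveB.
    exact: smooth_on_derivable (smooth_on_derive_along oU (sX i) (sZ i)) Ux.
  apply: diff_derivable; apply: differentiable_comp => //.
  exact: linear_differentiable.
rewrite E1 E2 E3 !CDl !CDr !CNl !CNr ND -NC.
move: ('D_(X i x) (fun y => _) x) ('D_(Y i x) (fun y => _) x) => a b.
move: (C _ _) (C _ _) (C _ _) (C _ _) (N _) => p q r s t.
by rewrite !opprD !opprK; apply/rowP => k; rewrite !mxE; ring.
Qed.

End ConstantConnection.

(** * The group Lambda and its orbit space *)

(** A non-integer lies strictly between its floor and the next integer, in an open interval free of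
    integers. *)
Lemma int_num_closed {R : realType} : closed [set x : R | x \is a Num.int_num].
Proof.
rewrite -[X in closed X]setCK; apply: open_closedC.
rewrite openE => x /= nx.
have fx : (Num.floor x)%:~R < x.
  rewrite lt_neqAle floor_le andbT; apply/eqP => E; apply: nx.
  by rewrite -E intr_int.
have fx1 := floorD1_gt x.
have : nbhs x `](Num.floor x)%:~R, (Num.floor x + 1)%:~R[%classic.
  by apply: open_nbhs_nbhs; split; [exact: interval_open|rewrite /= in_itv /= fx].
apply: filterS => y; rewrite /= in_itv /= => /andP[ya yb] /intrP[m Em]; move: ya yb; rewrite Em !ltr_int.
by rewrite ltzD1 ltNge => /negP.
Qed.

Lemma int_num_lt1 {R : realType} (x : R) : x \is a Num.int_num -> `|x| < 1 -> x = 0.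
Proof.
move=> xi; apply: contraTeq => x0; rewrite -leNgt; exact: norm_intr_ge1.
Qed.

Lemma row_norm_lt {R : realType} n (u : 'rV[R]_n) e : 0 < e ->
  `|u| < e <-> forall j, `|u ord0 j| < e.
Proof.
move=> e0; rewrite [`|u|]mx_normrE; split.
  move=> /bigmax_ltP[_ H] j; exact: H (ord0, j) isT.
by move=> H; apply/bigmax_ltP; split=> // -[i j] _ /=; rewrite ord1.
Qed.

Lemma row_second_countable {R : realType} n : @second_countable 'rV[R]_n.
Proof.
pose b (qk : 'rV[rat]_n * nat) : set 'rV[R]_n := ball (map_mx (@ratr R) qk.1 : 'rV[R]_n) qk.2.+1%:R^-1.
exists (range b); first exact: card_le_trans (card_image_le _ _) (countableP _).
split=> [_ [[q k] _ <-]|x A]; first exact: ball_open.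
move=> /nbhs_ballP[e /= e0 eA].
(* A ball of radius below [e / 2] that contains [x] lies in the ball of radius [e] about [x]. *)
have [|k] := @ltr_add_invr R 0 (e / 2); first by rewrite divr_gt0.
rewrite add0r => ke.
have d0 : 0 < k.+1%:R^-1 :> R by [].
have /fin_all_exists[q Hq] : forall j, exists q : rat, `|x ord0 j - ratr q| < k.+1%:R^-1.
  move=> j; have [|q] := @rat_in_itvoo R (x ord0 j - k.+1%:R^-1) (x ord0 j + k.+1%:R^-1).
    by rewrite ltrD2l gtrN.
  rewrite in_itv /= => /andP[q1 q2]; exists q.
  by rewrite ltr_distlC q1 q2.
pose qv : 'rV[rat]_n := \row_j q j.
have xq : `|x - map_mx ratr qv| < k.+1%:R^-1.
  by apply/row_norm_lt => // j; rewrite !mxE.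
exists (b (qv, k)); first split.
- by exists (qv, k).
- by rewrite /b /= -ball_normE /= distrC.
move=> y; rewrite /b /= -ball_normE /= => yq; apply: eA; rewrite -ball_normE /=.
rewrite -(subrK (map_mx ratr qv) x) -addrA (le_lt_trans (ler_normD _ _)) //.
by rewrite (splitr e); apply: ltrD; apply: lt_trans ke.
Qed.

Section NilGroup.
Context {R : realType}.
Local Notation V := 'rV[R]_4.
Implicit Types (s t u v : V) (a b c d : R).

(** The equations are paired rather than joined by a conjunction, so that [rewrite] treats them as
    one multirule. *)
Lemma vec4E a b c d : (vec4 a b c d ord0 i1 = a) * (vec4 a b c d ord0 i2 = b) *
  (vec4 a b c d ord0 i3 = c) * (vec4 a b c d ord0 i4 = d).
Proof. by rewrite !mxE. Qed.

Lemma forall_ord4 (P : 'I_4 -> Prop) : P i1 -> P i2 -> P i3 -> P i4 -> forall k, P k.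
Proof.
move=> P1 P2 P3 P4 [[|[|[|[|//]]]] p].
- by rewrite (_ : Ordinal p = i1) //; exact: val_inj.
- by rewrite (_ : Ordinal p = i2) //; exact: val_inj.
- by rewrite (_ : Ordinal p = i3) //; exact: val_inj.
- by rewrite (_ : Ordinal p = i4) //; exact: val_inj.
Qed.

Lemma row4P u v : u ord0 i1 = v ord0 i1 -> u ord0 i2 = v ord0 i2 ->
  u ord0 i3 = v ord0 i3 -> u ord0 i4 = v ord0 i4 -> u = v.
Proof. by move=> E1 E2 E3 E4; apply/rowP; exact: forall_ord4. Qed.

Lemma ddE (k j : 'I_4) : dd R k ord0 j = (j == k)%:R.
Proof. by rewrite mxE eqxx. Qed.

(** The Heisenberg group in the coordinates 1, 2, 4, times a line in the coordinate 3. *)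
Definition hmul s t : V := vec4
  (s ord0 i1 + t ord0 i1 + s ord0 i4 * t ord0 i2) (s ord0 i2 + t ord0 i2)
  (s ord0 i3 + t ord0 i3) (s ord0 i4 + t ord0 i4).

Definition hinv s : V := vec4
  (s ord0 i4 * s ord0 i2 - s ord0 i1) (- s ord0 i2) (- s ord0 i3) (- s ord0 i4).

Lemma hmulA : associative hmul.
Proof. by move=> s t u; apply: row4P; rewrite !vec4E; ring. Qed.

Lemma hmul0 : left_id 0 hmul.
Proof. by move=> s; apply: row4P; rewrite !vec4E !mxE; ring. Qed.

Lemma hmulr0 : right_id 0 hmul.
Proof. by move=> s; apply: row4P; rewrite !vec4E !mxE; ring. Qed.

Lemma hmulV : left_inverse 0 hinv hmul.
Proof. by move=> s; apply: row4P; rewrite !vec4E !mxE; ring. Qed.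

Lemma hmulrV : right_inverse 0 hinv hmul.
Proof. by move=> s; apply: row4P; rewrite !vec4E !mxE; ring. Qed.

Definition int_points : set V := [set s | forall k, s ord0 k \is a Num.int_num].

Lemma int_points_subgroup : is_subgroup hmul hinv 0 int_points.
Proof.
split=> [k|s t si ti|s si].
- by rewrite mxE rpred0.
- by apply: forall_ord4; rewrite vec4E ?rpredD ?rpredM ?si ?ti.
- by apply: forall_ord4; rewrite vec4E ?rpredB ?rpredN ?rpredM ?si.
Qed.

Lemma hmul_group : is_transformation_group [set hmul s | s in int_points].
Proof.
have [i0 iM iV] := int_points_subgroup.
split=> [|_ _ [s si <-] [t ti <-]|_ [s si <-]].
- by exists 0 => //; apply/funext => t; exact: hmul0.
- by exists (hmul s t); [exact: iM|apply/funext => u; rewrite /= hmulA].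
- exists (hmul (hinv s)); first by exists (hinv s) => //; exact: iV.
  by split=> t; rewrite hmulA ?hmulV ?hmulrV hmul0.
Qed.

(** Negative powers come from the inverse that the group is known to contain; the law of [f]
    identifies it with [f (Negz n)]. *)
Lemma transformation_group_pow (T : Type) (H : set (T -> T)) (f : int -> T -> T) :
  is_transformation_group H -> f 0 = id -> (forall m n, f (m + n) = f m \o f n) ->
  H (f 1) -> forall n, H (f n).
Proof.
move=> [H1 HM HV] f0 fD Hf1.
have Hn (n : nat) : H (f n%:Z).
  elim: n => [|n IH]; first by rewrite f0.
  by rewrite -addn1 PoszD fD; exact: HM.
case=> n; first exact: Hn.
have [g Hg [fK gK]] := HV _ (Hn n.+1).
suff -> : f (Negz n) = g by [].
apply/funext => x; rewrite -[LHS]fK NegzE; congr g.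
by rewrite -[LHS]/((f _ \o f _) x) -fD subrr f0.
Qed.

(** This replaces the abstractly generated group by explicit integer data, from which the properties
    of the quotient are read. *)
Lemma LambdaE : Lambda_set R = [set hmul s | s in int_points].
Proof.
apply/seteqP; split=> [f Lf|_ [s si <-]].
  apply: Lf; split; first exact: hmul_group.
  have gen k : int_points (dd R k) by move=> j; rewrite ddE natr_int.
  move=> _ [] ->.
  - exists (dd R i1); first exact: gen.
    by apply/funext => t; apply: row4P; rewrite !vec4E !(mxE, ddE) /=; ring.
  - exists (dd R i2); first exact: gen.
    by apply/funext => t; apply: row4P; rewrite !vec4E !(mxE, ddE) /=; ring.
  - exists (dd R i3); first exact: gen.
    by apply/funext => t; apply: row4P; rewrite !vec4E !(mxE, ddE) /=; ring.
  - exists (dd R i4); first exact: gen.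
    by apply/funext => t; apply: row4P; rewrite !vec4E !(mxE, ddE) /=; ring.
move=> H [HG Hgen]; have [_ HM _] := HG.
pose tr k (n : int) t : V := t + n%:~R *: dd R k.
have trH k : H (translation k) -> forall n, H (tr k n).
  move=> Hk; apply: transformation_group_pow => //.
  - by apply/funext => t; rewrite /tr scale0r addr0.
  - by move=> m n; apply/funext => t; rewrite /tr /= intrD scalerDl addrA addrAC.
  - by rewrite (_ : tr k 1 = translation k) //; apply/funext => t; rewrite /tr scale1r.
pose sh (n : int) t : V := vec4 (t ord0 i1 + n%:~R * t ord0 i2) (t ord0 i2)
  (t ord0 i3) (t ord0 i4 + n%:~R).
have shH n : H (sh n).
  apply: transformation_group_pow => //.
  - by apply/funext => t; apply: row4P; rewrite !vec4E; ring.
  - by move=> p q; apply/funext => t; apply: row4P; rewrite !vec4E ?intrD; ring.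
  - rewrite (_ : sh 1 = @shear R); first by apply: Hgen; exact: Or44.
    by apply/funext => t; apply: row4P; rewrite !vec4E ?mul1r.
have /intrP[a Ea] := si i1; have /intrP[b Eb] := si i2.
have /intrP[c Ec] := si i3; have /intrP[d Ed] := si i4.
(* The shear acts first and already supplies the term [s^4 t^2], so that three commuting
   translations remain. *)
have -> : hmul s = tr i1 a \o (tr i2 b \o (tr i3 c \o sh d)).
  apply/funext => t; apply: row4P; rewrite /= /tr !(vec4E, mxE) /= ?Ea ?Eb ?Ec ?Ed; ring.
apply: (HM); first by apply: trH; apply: Hgen; exact: Or41.
apply: (HM); first by apply: trH; apply: Hgen; exact: Or42.
by apply: (HM) => //; apply: trH; apply: Hgen; exact: Or43.
Qed.

Definition hlin s : 'M[R]_4 := 1%:M + s ord0 i4 *: delta_mx i2 i1.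

Lemma mul_hlin s v : v *m hlin s =
  vec4 (v ord0 i1 + s ord0 i4 * v ord0 i2) (v ord0 i2) (v ord0 i3) (v ord0 i4).
Proof.
have E : v *m hlin s = v + (s ord0 i4 * v ord0 i2) *: delta_mx ord0 i1.
  rewrite /hlin mulmxDr mulmx1; congr (_ + _); apply/rowP => j.
  rewrite -scalemxAr !mxE eqxx /= -mulrA; congr (_ * _).
  rewrite (bigD1 i2) //= big1 ?addr0 => [|k kn]; rewrite !mxE ?eqxx //=.
  by rewrite (negbTE kn) mulr0.
by rewrite E; apply: row4P; rewrite !(vec4E, mxE) /= ?mulr1 ?mulr0 ?addr0.
Qed.

Lemma hmul_affine s : hmul s = affine_map (hlin s, s).
Proof.
apply/funext => t; rewrite /affine_map /= mul_hlin.
by apply: row4P; rewrite !(vec4E, mxE); ring.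
Qed.

Lemma hlin_unit s : hlin s \in unitmx.
Proof.
suff : hlin s *m hlin (- s) = 1%:M by move=> /mulmx1_unit[].
rewrite /hlin mulmxDl mul1mx mulmxDr mulmx1 -scalemxAl -scalemxAr.
rewrite mul_delta_mx_0 // !scaler0 addr0 -addrA -scalerDl.
by rewrite mxE addNr scale0r addr0.
Qed.

Lemma Lambda_affine g : Lambda_set R g ->
  exists2 Ab, Ab.1 \in unitmx & g = affine_map Ab.
Proof.
by rewrite LambdaE => -[s _ <-]; exists (hlin s, s); [exact: hlin_unit|exact: hmul_affine].
Qed.

Lemma affine_map_inj : injective (@affine_map R).
Proof.
move=> [L b] [L' b'] E.
have Eb : b = b'.
  by have := congr1 (fun f => f 0) E; rewrite /affine_map /= !mul0mx !add0r.
congr pair => //; apply/row_matrixP => i; rewrite !rowE.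
have := congr1 (fun f => f (delta_mx ord0 i)) E.
by rewrite /affine_map /= Eb => /addIr.
Qed.

Lemma int_points_sep s s' : int_points s -> int_points s' -> `|s - s'| < 1 -> s = s'.
Proof.
move=> si s'i /row_norm_lt H; apply/rowP => j; apply/eqP; rewrite -subr_eq0.
apply/eqP; apply: int_num_lt1; first by rewrite rpredB.
by have := H ltr01 j; rewrite !mxE.
Qed.

(** An element of Lambda is recovered from its value at 0, which is an integer point; two elements
    at distance less than 1 therefore coincide. *)
Lemma Lambda_discrete :
  discrete_set [set Ab : 'M[R]_4 * V | Lambda_set R (affine_map Ab)].
Proof.
have inS Ab : Lambda_set R (affine_map Ab) -> int_points Ab.2 /\ affine_map Ab = hmul Ab.2.
  rewrite LambdaE => -[s si E]; suff <- : s = Ab.2 by [].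
  by rewrite -[s]hmulr0 E /affine_map mul0mx add0r.
move=> Ab LAb; split; first exact/mem_set.
exists (ball Ab 1); first exact: nbhsx_ballx.
apply/seteqP; split=> [Ab' [[_ B] LAb']|_ ->]; last first.
  by split=> //; exact: ballxx.
have [i1' E1] := inS _ LAb; have [i2' E2] := inS _ LAb'.
apply: affine_map_inj; rewrite E1 E2; congr hmul.
by apply/esym/int_points_sep => //; move: B; rewrite -ball_normE.
Qed.

Lemma derive_hmul s x v : 'D_v (hmul s) x = v *m hlin s.
Proof.
apply: derive_affine => h; rewrite hmul_affine /affine_map /=.
by rewrite mulmxDl -scalemxAl -addrA addrC.
Qed.

Lemma smooth_on_vec4 (V0 : normedModType R) (U : set V0) (f1 f2 f3 f4 : V0 -> R) :
  open U -> smooth_on U f1 -> smooth_on U f2 -> smooth_on U f3 -> smooth_on U f4 ->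
  smooth_on U (fun x => vec4 (f1 x) (f2 x) (f3 x) (f4 x)).
Proof.
move=> oU s1 s2 s3 s4; apply: smooth_on_row => //; apply: forall_ord4.
- by apply: smooth_on_eq oU _ s1 => x _; rewrite vec4E.
- by apply: smooth_on_eq oU _ s2 => x _; rewrite vec4E.
- by apply: smooth_on_eq oU _ s3 => x _; rewrite vec4E.
- by apply: smooth_on_eq oU _ s4 => x _; rewrite vec4E.
Qed.

Lemma smooth_on_hmul (V0 : normedModType R) (U : set V0) (f g : V0 -> V) : open U ->
  smooth_on U f -> smooth_on U g -> smooth_on U (fun x => hmul (f x) (g x)).
Proof.
move=> oU sf sg.
have cf k : smooth_on U (fun x => f x ord0 k) by exact: smooth_on_coord_comp.
have cg k : smooth_on U (fun x => g x ord0 k) by exact: smooth_on_coord_comp.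
apply: smooth_on_vec4 => //; try exact: smooth_on_add.
apply: smooth_on_add => //; first exact: smooth_on_add.
exact: smooth_on_mul.
Qed.

Lemma smooth_on_hinv (U : set V) : open U -> smooth_on U hinv.
Proof.
move=> oU.
have c k : smooth_on U (fun x : V => x ord0 k) by exact: smooth_on_coord.
have cN k : smooth_on U (fun x : V => - x ord0 k).
  apply: (smooth_on_eq oU (g := fun x : V => (-1 * x ord0 k : R))).
    by move=> x _; rewrite mulN1r.
  by apply: smooth_on_mul => //; exact: smooth_on_cst.
apply: smooth_on_vec4 => //.
by apply: smooth_on_add => //; exact: smooth_on_mul.
Qed.

Lemma smooth_on_id (W : normedModType R) (U : set W) : smooth_on U id.
Proof. by apply: (@smooth_on_linear _ _ _ U idfun) => x. Qed.

Lemma Lambda_smooth g : tg_set (Lambda R) g -> smooth_on setT g.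
Proof.
rewrite /= LambdaE => -[s _ <-]; apply: smooth_on_hmul; first exact: openT.
  exact: smooth_on_cst.
exact: smooth_on_id.
Qed.

Lemma Lambda_continuous g : tg_set (Lambda R) g -> continuous g.
Proof. by move=> /Lambda_smooth/(_ 0%N) gc x; exact: gc. Qed.

Lemma Lambda_projP x y : orbit_proj (Lambda R) x = orbit_proj (Lambda R) y <->
  exists2 s, int_points s & hmul s x = y.
Proof.
rewrite orbit_projP /= LambdaE; split=> [[_ [s si <-] E]|[s si E]]; first by exists s.
by exists (hmul s) => //; exists s.
Qed.

(** Solving [hmul s x = y] for [s] gives these four expressions as the coordinates of [s]. They are
    continuous in [(x, y)], which makes the orbit relation closed. *)
Lemma Lambda_proj_coord x y : orbit_proj (Lambda R) x = orbit_proj (Lambda R) y <->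
  [/\ y ord0 i2 - x ord0 i2 \is a Num.int_num, y ord0 i3 - x ord0 i3 \is a Num.int_num,
      y ord0 i4 - x ord0 i4 \is a Num.int_num &
      y ord0 i1 - x ord0 i1 - (y ord0 i4 - x ord0 i4) * x ord0 i2 \is a Num.int_num].
Proof.
rewrite Lambda_projP; split=> [[s si <-]|[h2 h3 h4 h1]].
  rewrite !vec4E !addrK; split=> //.
  rewrite (_ : _ - _ = s ord0 i1) //; ring.
exists (vec4 (y ord0 i1 - x ord0 i1 - (y ord0 i4 - x ord0 i4) * x ord0 i2)
  (y ord0 i2 - x ord0 i2) (y ord0 i3 - x ord0 i3) (y ord0 i4 - x ord0 i4)).
  by apply: forall_ord4; rewrite vec4E.
by apply: row4P; rewrite !vec4E; ring.
Qed.

Lemma Lambda_closed :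
  closed [set xy : V * V | orbit_proj (Lambda R) xy.1 = orbit_proj (Lambda R) xy.2].
Proof.
pose Z := [set x : R | x \is a Num.int_num].
have c1 k : continuous (fun xy : V * V => xy.1 ord0 k : R).
  by move=> xy; apply: (@continuous_comp _ _ _ fst (fun v : V => v ord0 k)); [exact: cvg_fst|exact: coord_continuous].
have c2 k : continuous (fun xy : V * V => xy.2 ord0 k : R).
  by move=> xy; apply: (@continuous_comp _ _ _ snd (fun v : V => v ord0 k)); [exact: cvg_snd|exact: coord_continuous].
have cd k : continuous (fun xy : V * V => xy.2 ord0 k - xy.1 ord0 k).
  by move=> xy; apply: cvgB; [exact: c2|exact: c1].
pose d k (xy : V * V) := xy.2 ord0 k - xy.1 ord0 k.
pose e1 (xy : V * V) := d i1 xy - d i4 xy * xy.1 ord0 i2.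
rewrite (_ : [set _ | _] = d i2 @^-1` Z `&` (d i3 @^-1` Z `&` (d i4 @^-1` Z `&` e1 @^-1` Z))).
  have cl (f : V * V -> R) : continuous f -> closed (f @^-1` Z).
    by move=> fc; apply: preimage_closed => //; exact: int_num_closed.
  do 3 (apply: closedI; first exact/cl/cd); apply: cl => xy.
  by apply: cvgB; [exact: cd|apply: cvgM; [exact: cd|exact: c1]].
apply/seteqP; split=> xy /=; first by move=> /Lambda_proj_coord[].
by move=> [h2 [h3 [h4 h1]]]; apply/Lambda_proj_coord.
Qed.

Lemma Lambda_locally_injective x :
  exists U : set V, [/\ open U, U x & {in U &, injective (orbit_proj (Lambda R))}].
Proof.
(* Points of a ball of radius 1/2 have coordinates less than 1 apart, so integral differences
   vanish. *)
exists (ball x (1 / 2)); split; [exact: ball_open|by apply: ballxx; rewrite divr_gt0|].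
move=> y y' /set_mem + /set_mem; rewrite -ball_normE /= => yx y'x /Lambda_proj_coord.
have small k : `|y' ord0 k - y ord0 k| < 1.
  have : `|y' - y| < 1.
    rewrite (_ : y' - y = (x - y) - (x - y')); last by rewrite opprB [RHS]addrC addrA subrK.
    by rewrite (le_lt_trans (ler_normB _ _)) // [ltRHS](splitr 1) ltrD.
  by move/row_norm_lt => /(_ ltr01 k); rewrite !mxE.
move=> [/int_num_lt1 h2 /int_num_lt1 h3 /int_num_lt1 h4].
(* Once the fourth coordinates agree, the shear correction drops out of the condition on the
   first. *)
rewrite h4 // mul0r subr0 => /int_num_lt1 h1.
by apply: row4P; apply/esym/eqP; rewrite -subr_eq0; apply/eqP; [exact: h1|exact: h2|exact: h3|exact: h4].
Qed.

Lemma nilA_smooth_manifold : smooth_manifold (nilA R).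
Proof.
apply: orbit_smooth_manifold.
- exact: Lambda_continuous.
- exact: Lambda_smooth.
- exact: row_second_countable.
- exact: Lambda_closed.
- exact: Lambda_locally_injective.
Qed.

Lemma nilM_compact : compact [set: nilM R].
Proof.
pose box : set V := [set v | forall k, `[(0 : R), 1]%classic (v ord0 k)].
have -> : [set: nilM R] = orbit_proj (Lambda R) @` box.
  apply/seteqP; split=> // p _; have [x <-] := orbit_proj_surj p.
  pose n (a : R) : R := (Num.floor a)%:~R.
  have n01 a : 0 <= a - n a <= 1.
    have /andP[h1 h2] := floor_itv a; rewrite subr_ge0 h1 /=.
    by move: h2; rewrite intrD => h2; rewrite lerBlDl addrC ltW // addrC.
  have nint a : n a \is a Num.int_num by exact: intr_int.
  (* Reducing the fourth coordinate shears the first by [- n (x ord0 i4) * x ord0 i2], so the floor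
     for the first is taken after this shift. *)
  pose s := vec4 (- n (x ord0 i1 - n (x ord0 i4) * x ord0 i2))
    (- n (x ord0 i2)) (- n (x ord0 i3)) (- n (x ord0 i4)).
  exists (hmul s x).
    apply: forall_ord4; rewrite /= in_itv /= !vec4E.
    - by have := n01 (x ord0 i1 - n (x ord0 i4) * x ord0 i2); lra.
    - by rewrite addrC.
    - by rewrite addrC.
    - by rewrite addrC.
  apply/esym/Lambda_projP; exists s => //.
  by apply: forall_ord4; rewrite vec4E rpredN.
apply: continuous_compact.
  by apply: continuous_subspaceT => x; exact: orbit_proj_continuous.
by apply: (@rV_compact R 4 (fun=> `[(0 : R), 1]%classic)) => _; exact: segment_compact.
Qed.

End NilGroup.

(** * The nilmanifold and its connections *)

Section SimplyConnected.
Context {R : realType} {V : normedModType R}.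
Local Notation I := (`[0, 1]%classic : set R).

(** Paths are segments, and loops contract by the straight-line homotopy to the base point, which
    fixes the endpoints since these already equal [x]. *)
Lemma normed_simply_connected : simply_connected R V.
Proof.
split; first by exists 0.
  move=> x y; exists (fun s => x + s *: (y - x)); split.
  - apply: continuous_subspaceT => s; apply: cvgD; first exact: cvg_cst.
    by apply: cvgZ; [exact: cvg_id|exact: cvg_cst].
  - by rewrite scale0r addr0.
  - by rewrite scale1r addrC subrK.
move=> x g [/subspace_continuousP gc g0 g1].
exists (fun p => g p.2 + p.1 *: (x - g p.2)); split.
- apply/subspace_continuousP => -[r s] /= [Ir Is].
  (* [g] is continuous only within [I], so the limit is computed by hand along the product filter
     restricted to the square. *)
  have cg : g p.2 @[p --> within (I `*` I) (nbhs (r, s))] --> g s.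
    move=> A /(gc s Is) nA.
    have nA' : nbhs s (fun t => I t -> A (g t)) by exact: nA.
    exists (setT, fun t => I t -> A (g t)); first by split=> //; exact: filterT.
    by move=> p [_ pA] [_ Ip]; exact: pA.
  have c1 : p.1 @[p --> within (I `*` I) (nbhs (r, s))] --> r.
    move=> A nA; exists (A, setT); first by split=> //; exact: filterT.
    by move=> p [pA _] _; exact: pA.
  apply: cvgD => //; apply: cvgZ => //; apply: cvgB => //; exact: cvg_cst.
- by move=> s _; rewrite /= scale0r addr0.
- by move=> s _; rewrite /= scale1r addrC subrK.
- by move=> r _; rewrite /= g0 g1 subrr scaler0 addr0.
Qed.

End SimplyConnected.

Lemma model_smooth_manifold {R : realType} (V : normedModType R) :
  @second_countable V -> smooth_manifold (model_atlas V).
Proof.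
move=> sV; split.
- by split=> //; exact: norm_hausdorff.
- by move=> p; exists tt; exists p.
- move=> i; split; [exact: openT|by rewrite /patch_of /= image_id; exact: openT|by []].
- by move=> i; split=> [x _|x _]; exact: cvg_id.
- by move=> i j; apply: smooth_on_id.
Qed.

Section NilManifold.
Context {R : realType}.
Local Notation V := 'rV[R]_4.
Local Notation proj := (orbit_proj (Lambda R)).

Lemma smooth_on_fst (W W' : normedModType R) (U : set (W * W')) : smooth_on U fst.
Proof. by apply: (@smooth_on_linear _ _ _ _ fst) => q; exact: cvg_fst. Qed.

Lemma smooth_on_snd (W W' : normedModType R) (U : set (W * W')) : smooth_on U snd.
Proof. by apply: (@smooth_on_linear _ _ _ _ snd) => q; exact: cvg_snd. Qed.

Lemma hmul_lie_group : lie_group (model_atlas V) hmul hinv 0.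
Proof.
have sm : smooth_on setT (fun xy : V * V => hmul xy.1 xy.2).
  apply: smooth_on_hmul; [exact: openT|exact: smooth_on_fst|exact: smooth_on_snd].
have si : smooth_on setT (@hinv R) by apply: smooth_on_hinv; exact: openT.
split.
- exact/model_smooth_manifold/row_second_countable.
- by split; [exact: hmulA|exact: hmul0|exact: hmulV].
- split=> [p _|i j]; first exact: (sm 0%N).
  exact: smooth_on_sub sm.
- split=> [p _|i j]; first exact: (si 0%N).
  exact: smooth_on_sub si.
Qed.

(** Non-commutativity shows only in the first coordinate, so commutators lie in the first axis; that
    axis is central, and the series stops after two steps. *)
Lemma hmul_nilpotent : nilpotent_group (@hmul R) hinv 0.
Proof.
pose Z : set V := [set z | [/\ z ord0 i2 = 0, z ord0 i3 = 0 & z ord0 i4 = 0]].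
have ZS : is_subgroup (@hmul R) hinv 0 Z.
  split; first by split; rewrite mxE.
    move=> x y [x2 x3 x4] [y2 y3 y4].
    by split; rewrite vec4E ?x2 ?x3 ?x4 ?y2 ?y3 ?y4 addr0.
  by move=> x [x2 x3 x4]; split; rewrite vec4E ?x2 ?x3 ?x4 oppr0.
have L1 : lower_central (@hmul R) hinv 0 1 `<=` Z.
  move=> z; apply; split=> // _ [x [y [_ ->]]].
  by rewrite /commutator; split; rewrite !vec4E; ring.
exists 2%N; apply/seteqP; split=> [z|_ ->]; last by move=> H [[]].
apply; split.
  split=> // [x y -> ->|x ->]; first by rewrite hmul0.
  by apply: row4P; rewrite vec4E !mxE; ring.
move=> _ [x [y [/L1[x2 x3 x4] ->]]]; apply: row4P.
all: by rewrite /commutator !vec4E !mxE ?x2 ?x3 ?x4; ring.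
Qed.

Lemma nilA_nilmanifold : nilmanifold (nilA R).
Proof.
exists V, (model_atlas V), hmul, hinv, 0, int_points, proj; split.
- exact: hmul_lie_group.
- by split; [exact: normed_simply_connected|exact: hmul_nilpotent].
- split; first exact: int_points_subgroup.
  move=> s si; split; first exact/mem_set.
  exists (ball s 1); first exact: nbhsx_ballx.
  apply/seteqP; split=> [t [st ti]|_ ->]; last by split=> //; exact: ballxx.
  by apply/esym/int_points_sep => //; move: st; rewrite -ball_normE.
- split; last by move=> x y; exact: Lambda_projP.
  by move=> p _; have [x <-] := orbit_proj_surj p; exists x.
(* A chart of the orbit atlas around the image of [x] is itself the local inverse of the
   projection. *)
move=> x; have [U [oU Ux iU]] := Lambda_locally_injective x.
pose i : ix (nilA R) := exist _ U (conj oU iU).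
have Lc := @Lambda_continuous R; have Ls := @Lambda_smooth R.
exists U, (crd i); split.
- by [].
- exact: (@patch_open _ _ _ Lc i).
- by move=> y /set_mem Uy; exact: (@crdK _ _ _ i).
- split=> [y _|k j]; first exact: orbit_proj_continuous.
  by apply: smooth_on_sub (@smooth_crd_proj _ _ _ Lc Ls j) => y [].
- split=> [p Up|k j]; first exact: (@crd_continuous _ _ _ Lc i).
  by apply: smooth_on_sub (@smooth_crd_proj _ _ _ Lc Ls i) => y [].
Qed.

End NilManifold.

(** * The invariant frame, the symplectic form and the explicit connections *)

Section NilConnection.
Context {R : realType}.
Local Notation V := 'rV[R]_4.
Local Notation A := (nilA R).
Implicit Types (s t u v : V) (beta b : R) (k j : 'I_4).

Lemma E_vec4 k t : E k t = [:: vec4 1 0 0 0; vec4 (t ord0 i4) 1 0 0;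
  vec4 0 0 1 0; vec4 0 0 0 1]`_k :> V.
Proof.
move: k; apply: forall_ord4; apply: row4P.
all: by rewrite /E /= !mxE /= ?mulr1 ?mulr0 ?addr0 ?add0r.
Qed.

Lemma E_dual k j t : e k t (E j t) = (k == j)%:R :> R.
Proof.
rewrite E_vec4; move: k j; apply: forall_ord4; apply: forall_ord4.
all: by rewrite /e /= !vec4E /= ?mulr1 ?mulr0 ?subrr ?subr0.
Qed.

Lemma E_invariant k : invariant_field (Lambda R) (E k).
Proof.
move=> g; rewrite /= LambdaE => -[s _ <-] x; rewrite derive_hmul mul_hlin !E_vec4.
move: k; apply: forall_ord4; apply: row4P.
all: by rewrite /= !vec4E; ring.
Qed.

Lemma e_invariant k : invariant_oneform (Lambda R) (e k).
Proof.
move=> g; rewrite /= LambdaE => -[s _ <-] x v; rewrite derive_hmul mul_hlin.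
by move: k; apply: forall_ord4; rewrite /e /= !vec4E; ring.
Qed.

Lemma smooth_E k : smooth_on setT (E k : V -> V).
Proof.
have oT := @openT V.
have sc j : smooth_on setT (fun t : V => t ord0 j : R) by exact: smooth_on_coord.
apply: (smooth_on_eq oT (fun x _ => E_vec4 k x)).
move: k; apply: forall_ord4; try exact: smooth_on_cst.
by apply: smooth_on_vec4 => //; exact: smooth_on_cst.
Qed.

Lemma smooth_e k v : smooth_on setT (fun t : V => e k t v).
Proof.
have oT := @openT V.
have sc j : smooth_on setT (fun t : V => t ord0 j : R) by exact: smooth_on_coord.
move: k; apply: forall_ord4; try exact: smooth_on_cst.
apply: (smooth_on_eq oT (g := fun t : V => v ord0 i1 + t ord0 i4 * - v ord0 i2)).
  by move=> t _; rewrite /e /= mulrN.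
apply: smooth_on_add => //; first exact: smooth_on_cst.
by apply: smooth_on_mul => //; exact: smooth_on_cst.
Qed.

Lemma scalar_e k t : scalar (e k t : V -> R).
Proof.
by move=> a u v; move: k; apply: forall_ord4; rewrite /e /= !mxE; ring.
Qed.

Lemma is_field_nilE k : is_field (nilE R k).
Proof.
apply: is_field_descend.
- exact: Lambda_continuous.
- exact: smooth_E.
- exact: E_invariant.
Qed.

Lemma nilE_E k (i : ix A) x : cdom i x -> nilE R k i x = E k x.
Proof. exact: descend_fieldE. Qed.

Lemma is_oneform_nile k : is_oneform (nile R k).
Proof.
apply: is_oneform_descend.
- exact: Lambda_continuous.
- exact: scalar_e.
- exact: smooth_e.
- exact: e_invariant.
Qed.

Lemma nil_frame (i : ix A) x v : cdom i x ->
  v = \sum_k nile R k i x v *: nilE R k i x.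
Proof.
move=> Ux.
rewrite (eq_bigr (fun k => e k x v *: E k x)); last first.
  by move=> k _; congr (_ *: _); [exact: descend_oneformE|exact: descend_fieldE].
rewrite !big_ord_recl big_ord0 !E_vec4 /e /=.
by apply: row4P; rewrite !mxE /= ?vec4E; ring.
Qed.

Definition om u v : R :=
  u ord0 i1 * v ord0 i2 - u ord0 i2 * v ord0 i1 +
  (u ord0 i3 * v ord0 i4 - u ord0 i4 * v ord0 i3).

(** The term [t^4 dt^2] of [e^1] drops out of the wedge with [e^2 = dt^2]. *)
Lemma OmegaE t u v : Omega t u v = om u v.
Proof. by rewrite /Omega /wedge /e /om /=; ring. Qed.

Lemma om_scalarl v : scalar (om ^~ v).
Proof. by move=> a u u'; rewrite /om !mxE; ring. Qed.

Lemma om_scalarr u : scalar (om u).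
Proof. by move=> a v v'; rewrite /om !mxE; ring. Qed.

Lemma nilOmegaE (i : ix A) x u v : cdom i x -> nilOmega R i x u v = om u v.
Proof. by move=> Ux; rewrite -(OmegaE x); exact: descend_twoformE. Qed.

Lemma om_nondegenerate u : (forall v, om u v = 0) -> u = 0.
Proof.
move=> H; apply: row4P; rewrite mxE.
- by have := H (vec4 0 1 0 0); rewrite /om !vec4E; lra.
- by have := H (vec4 1 0 0 0); rewrite /om !vec4E; lra.
- by have := H (vec4 0 0 0 1); rewrite /om !vec4E; lra.
- by have := H (vec4 0 0 1 0); rewrite /om !vec4E; lra.
Qed.

Lemma nilOmega_symplectic : symplectic_form (nilOmega R).
Proof.
split.
- apply: is_twoform_descend.
  + exact: Lambda_continuous.
  + move=> x v; split=> [a u u'|a u u'|]; rewrite !OmegaE ?om_scalarl ?om_scalarr //.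
    by rewrite /om; ring.
  + move=> u v; apply: (smooth_on_eq openT (g := cst (om u v))).
      by move=> x _; rewrite OmegaE.
    exact: smooth_on_cst.
  + move=> g; rewrite /= LambdaE => -[s _ <-] x u v.
    by rewrite !derive_hmul !OmegaE !mul_hlin /om !vec4E; ring.
- move=> i x u v z Ux.
  have D a p q : 'D_a (fun y => nilOmega R i y p q) x = 0.
    rewrite -[RHS](derive_cst (om p q) x a); apply: near_eq_derive.
    by apply: (open_near (cdom_open i) Ux) => y; exact: nilOmegaE.
  by rewrite /ext_deriv !D subrr addr0.
- by move=> i x u Ux H; apply: om_nondegenerate => v; rewrite -(nilOmegaE _ _ Ux).
Qed.

(* With [b = beta + 1 / 3] these are the Christoffel symbols in the coordinates
   t^k. *)
Definition christoffel b u v : V := vec4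
  (- b * (u ord0 i4 * v ord0 i2 + u ord0 i2 * v ord0 i4)) 0
  (- b * (u ord0 i2 * v ord0 i2)) 0.

Definition nil_connection beta : field A -> field A -> field A :=
  const_connection (christoffel (beta + 1 / 3)).

Lemma christoffel_linearl b v : linear (christoffel b ^~ v).
Proof. by move=> a u u'; apply: row4P; rewrite !(vec4E, mxE); ring. Qed.

Lemma christoffel_linearr b u : linear (christoffel b u).
Proof. by move=> a v v'; apply: row4P; rewrite !(vec4E, mxE); ring. Qed.

(** [christoffel] reads only the coordinates 2 and 4 and produces only 1 and 3. The linear part of
    an element of Lambda changes neither the coordinates read nor any vector with vanishing second
    coordinate. *)
Lemma christoffel_invariant b g : tg_set (Lambda R) g ->
  affine_preserves (christoffel b) g.
Proof.
rewrite /= LambdaE => -[s _ <-]; exists (hlin s), s; split.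
  by move=> t; rewrite hmul_affine.
by move=> u v; apply: row4P; rewrite !mul_hlin !vec4E; ring.
Qed.

Lemma nil_connection_is_connection beta : is_connection (nil_connection beta).
Proof.
apply: const_connection_is_connection.
- exact: nilA_smooth_manifold.
- exact: Lambda_continuous.
- exact: christoffel_linearl.
- exact: christoffel_linearr.
- exact: christoffel_invariant.
Qed.

Lemma derive_E k x v : 'D_v (E k) x = vec4 (if k == i2 then v ord0 i4 else 0) 0 0 0.
Proof.
apply: derive_affine => h; rewrite !E_vec4.
by move: k; apply: forall_ord4; apply: row4P; rewrite !(vec4E, mxE) /= ?vec4E; ring.
Qed.

Lemma derive_nilE k (i : ix A) x v : cdom i x ->
  'D_v (nilE R k i) x = vec4 (if k == i2 then v ord0 i4 else 0) 0 0 0.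
Proof.
move=> Ux; rewrite -(derive_E k x); apply: near_eq_derive.
by apply: (open_near (cdom_open i) Ux) => y; exact: descend_fieldE.
Qed.

Lemma nil_connection_spec beta : nabla_spec beta (nil_connection beta).
Proof.
have [fN _ _ _ _] := nil_connection_is_connection beta.
have out k j (i : ix A) x : ~ cdom i x ->
    nil_connection beta (nilE R k) (nilE R j) i x = 0.
  by have [_ z _] := fN _ _ (is_field_nilE k) (is_field_nilE j); exact: z.
have ins k j (i : ix A) x : cdom i x ->
    nil_connection beta (nilE R k) (nilE R j) i x =
    vec4 (if j == i2 then E k x ord0 i4 else 0) 0 0 0 +
    christoffel (beta + 1 / 3) (E k x) (E j x).
  move=> Ux; rewrite /nil_connection /const_connection derive_nilE //.
  by rewrite !(nilE_E _ Ux).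
have spec k j (f : R) l : (forall x,
    vec4 (if j == i2 then E k x ord0 i4 else 0) 0 0 0 +
    christoffel (beta + 1 / 3) (E k x) (E j x) = f *: E l x :> V) ->
    nil_connection beta (nilE R k) (nilE R j) = mulf (fun=> f) (nilE R l).
  move=> H; apply/funext => i; apply/funext => x; rewrite /mulf.
  have [Ux|nUx] := pselect (cdom i x).
    by rewrite ins // H; congr (_ *: _); apply: esym; exact: descend_fieldE.
  by rewrite out //; have [_ z _] := is_field_nilE l; rewrite z // scaler0.
split.
(* Here the derivative of [t^4] along [E_4] contributes 1, and
   [1 - (beta + 1 / 3) = - (beta - 2 / 3)]. *)
- by apply: spec => x; apply: row4P; rewrite !E_vec4 !(vec4E, mxE) /= ?vec4E; field.
- by apply: spec => x; apply: row4P; rewrite !E_vec4 !(vec4E, mxE) /= ?vec4E; field.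
- by apply: spec => x; apply: row4P; rewrite !E_vec4 !(vec4E, mxE) /= ?vec4E; field.
move=> k j kj; rewrite -(mulf0 (nilE R i1)); apply: spec => x; rewrite scale0r.
move: k j kj; apply: forall_ord4; apply: forall_ord4 => //= _.
all: by apply: row4P; rewrite !E_vec4 !(vec4E, mxE) /= ?vec4E; ring.
Qed.

Lemma nabla_spec_unique beta (nabla nabla' : field A -> field A -> field A) :
  is_connection nabla -> nabla_spec beta nabla ->
  is_connection nabla' -> nabla_spec beta nabla' ->
  forall X Y, is_field X -> is_field Y -> nabla X Y = nabla' X Y.
Proof.
move=> cn [n1 n2 n3 n4] cn' [n1' n2' n3' n4'].
apply: (connection_unique nilA_smooth_manifold is_field_nilE is_oneform_nile
  nil_frame cn cn') => k j.
case: (boolP ((k, j) \in [:: (i4, i2); (i2, i4); (i2, i2)])) => [|kj].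
  rewrite !inE => /or3P[] /eqP[-> ->]; first by rewrite n1 n1'.
    by rewrite n2 n2'.
  by rewrite n3 n3'.
by rewrite n4 // n4'.
Qed.

Lemma nil_connection_torsion_free beta : torsion_free (nil_connection beta).
Proof.
apply: const_connection_torsion_free => u v.
by apply: row4P; rewrite !vec4E; ring.
Qed.

Lemma nil_connection_flat beta : flat (nil_connection beta).
Proof.
apply: const_connection_flat.
- exact: nilA_smooth_manifold.
- exact: Lambda_continuous.
- exact: christoffel_linearl.
- exact: christoffel_linearr.
- exact: christoffel_invariant.
(* The coordinates produced by [christoffel] are never among those it reads, so composites
   vanish. *)
- by move=> u v w; apply: row4P; rewrite !vec4E !mxE; ring.
- by move=> u v w; apply: row4P; rewrite !vec4E !mxE; ring.
Qed.

Lemma nil_connection_parallel beta : parallel (nil_connection beta) (nilOmega R).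
Proof.
have pC u v z : om (christoffel (beta + 1 / 3) u v) z +
    om v (christoffel (beta + 1 / 3) u z) = 0 by rewrite /om !vec4E; ring.
exact: (const_connection_parallel nilA_smooth_manifold
  (fun i x u v Ux => nilOmegaE u v Ux) om_scalarl om_scalarr pC).
Qed.

Lemma nil_connection_lie beta :
  infinitesimal_automorphism (nil_connection beta) (nilE R i2).
Proof.
pose N v : V := vec4 (v ord0 i4) 0 0 0.
(* All three terms are 0: [N] produces the coordinate 1, which [christoffel] does not read, and
   reads the coordinate 4, which [christoffel] does not produce. *)
have NC u v : christoffel (beta + 1 / 3) (N u) v + christoffel (beta + 1 / 3) u (N v) =
    N (christoffel (beta + 1 / 3) u v).
  by apply: row4P; rewrite !(vec4E, mxE); ring.
have EN (i : ix A) x v : cdom i x -> 'D_v (nilE R i2 i) x = N v.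
  by move=> Ux; rewrite derive_nilE.
exact: (const_connection_lie nilA_smooth_manifold (@Lambda_continuous R)
  (christoffel_linearl _) (christoffel_linearr _)
  (fun g => @christoffel_invariant _ g) (is_field_nilE i2) EN NC).
Qed.

Lemma nil_chart : exists (i : ix A) (x : V), cdom i x.
Proof.
have [U [oU Ux iU]] := @Lambda_locally_injective R 0.
by exists (exist _ U (conj oU iU)), 0.
Qed.

Lemma nilE2_not_symplectic : ~ symplectic_field (nilOmega R) (nilE R i2).
Proof.
have [i [x Ux]] := nil_chart.
(* The pair [(E_4, E_2)] is a witness: Omega(E_4, E_2) is constant, [[E_2, E_4] = - E_1], and
   Omega(E_1, E_2) = 1. *)
move=> /(_ _ _ (is_field_nilE i4) (is_field_nilE i2) i x Ux).
rewrite /lie_form !nilOmegaE // /bracket !derive_nilE // !(nilE_E _ Ux).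
have -> : 'D_(E i2 x) (fun y => nilOmega R i y (nilE R i4 i y) (nilE R i2 i y)) x = 0.
  rewrite -[RHS](derive_cst (0 : R) x (E i2 x)); apply: near_eq_derive.
  apply: (open_near (cdom_open i) Ux) => y Uy.
  rewrite nilOmegaE // !(nilE_E _ Uy) !E_vec4 /om /= !vec4E; ring.
by rewrite !E_vec4 /om /= !mxE /=; lra.
Qed.

Lemma nil_connection_neq beta beta' : beta != beta' ->
  nil_connection beta (nilE R i2) (nilE R i2) <>
  nil_connection beta' (nilE R i2) (nilE R i2).
Proof.
move=> bb' H; have [i [x Ux]] := nil_chart.
(* The third coordinate of [nabla_{E_2} E_2] is [- (beta + 1 / 3)], from which [beta] is
   recovered. *)
have := congr1 (fun N : field A => N i x ord0 i3) H.
rewrite /nil_connection /const_connection !derive_nilE // !(nilE_E _ Ux).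
rewrite !E_vec4 /= !mxE /= => E3; move/eqP: bb'; apply; lra.
Qed.

End NilConnection.

(** * Transfer of properties between connections that agree on fields *)

Section Transfer.
Context {R : realType} {V : normedModType R} {M : topologicalType} {A : atlas V M}.
Context (nabla nabla' : field A -> field A -> field A) (cn : is_connection nabla').
Context (E : forall X Y, is_field X -> is_field Y -> nabla X Y = nabla' X Y).

Let fN X Y : is_field X -> is_field Y -> is_field (nabla' X Y).
Proof. by have [f _ _ _ _] := cn; exact: f. Qed.

Lemma eq_torsion_free : torsion_free nabla' -> torsion_free nabla.
Proof. by move=> H X Y fX fY; rewrite /torsion !E //; exact: H. Qed.

(** Agreement is known on fields only, so each inner argument, bracket or covariant derivative, must
    first be known to be a field. *)
Lemma eq_flat : (forall X Y : field A, is_field X -> is_field Y -> is_field (bracket X Y)) ->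
  flat nabla' -> flat nabla.
Proof.
move=> fb H X Y Z fX fY fZ; rewrite /curvature (E fY fZ) (E fX fZ).
rewrite (E fX (fN fY fZ)) (E fY (fN fX fZ)) (E (fb _ _ fX fY) fZ); exact: H.
Qed.

Lemma eq_parallel w : parallel nabla' w -> parallel nabla w.
Proof.
move=> H X Y Z fX fY fZ i x Ux; rewrite /cov_deriv (E fX fY) (E fX fZ); exact: H.
Qed.

Lemma eq_infinitesimal_automorphism X :
  (forall X Y : field A, is_field X -> is_field Y -> is_field (bracket X Y)) -> is_field X ->
  infinitesimal_automorphism nabla' X -> infinitesimal_automorphism nabla X.
Proof.
move=> fb fX H Y Z fY fZ; rewrite /lie_connection (E fY fZ).
rewrite (E (fb _ _ fX fY) fZ) (E fY (fb _ _ fX fZ)); exact: H.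
Qed.

End Transfer.

Lemma is_field_nil_bracket {R : realType} (X Y : field (nilA R)) :
  is_field X -> is_field Y -> is_field (bracket X Y).
Proof.
exact: (is_field_bracket nilA_smooth_manifold (@Lambda_continuous R)
  (* The parameter 0 is arbitrary: the invariance serves to show that Lambda acts by affine maps. *)
  (fun g => @christoffel_invariant _ 0 g)).
Qed.

Theorem mainTheorem2 (R : realType) :
  (* Lambda is a discrete group of affine transformations *)
  ((forall g, Lambda_set R g -> exists2 Ab, Ab.1 \in unitmx & g = affine_map Ab) /\
   discrete_set [set Ab : 'M[R]_4 * 'rV[R]_4 | Lambda_set R (affine_map Ab)]) /\
  (* M = R^4 / Lambda is a compact four-dimensional nilmanifold *)
  [/\ smooth_manifold (nilA R), compact [set: nilM R] & nilmanifold (nilA R)] /\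
  (* the dual frames e^k, E_k are invariant and descend; Omega is symplectic *)
  [/\ forall i j t, e i t (E j t) = (i == j)%:R :> R,
      forall k, invariant_field (Lambda R) (E k),
      forall k, invariant_oneform (Lambda R) (e k),
      forall k, is_field (nilE R k) /\ is_oneform (nile R k) &
      symplectic_form (nilOmega R)] /\
  (* the connections *)
  (forall beta : R,
    [/\ exists nabla, is_connection nabla /\ nabla_spec beta nabla,
        forall nabla nabla',
          is_connection nabla -> nabla_spec beta nabla ->
          is_connection nabla' -> nabla_spec beta nabla' ->
          forall X Y, is_field X -> is_field Y -> nabla X Y = nabla' X Y &
        forall nabla, is_connection nabla -> nabla_spec beta nabla ->
          [/\ torsion_free nabla, flat nabla, parallel nabla (nilOmega R),
              infinitesimal_automorphism nabla (nilE R i2) &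
              ~ symplectic_field (nilOmega R) (nilE R i2)]]) /\
  (* the existence statement *)
  (exists (M : topologicalType) (A : atlas 'rV[R]_4 M) (w : twoform A)
          (nabla : R -> field A -> field A -> field A),
    [/\ [/\ smooth_manifold A, compact [set: M] & nilmanifold A],
        symplectic_form w,
        forall beta beta', beta != beta' ->
          exists X Y, [/\ is_field X, is_field Y & nabla beta X Y <> nabla beta' X Y] &
        forall beta,
          [/\ symplectic_connection w (nabla beta), flat (nabla beta) &
              exists X, [/\ is_field X, infinitesimal_automorphism (nabla beta) X &
                            ~ symplectic_field w X]]]).
Proof.
have man : [/\ smooth_manifold (nilA R), compact [set: nilM R] & nilmanifold (nilA R)].
  by split; [exact: nilA_smooth_manifold|exact: nilM_compact|exact: nilA_nilmanifold].
split; first by split; [exact: Lambda_affine|exact: Lambda_discrete].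
split=> //; split.
  split; [exact: E_dual|exact: E_invariant|exact: e_invariant| |exact: nilOmega_symplectic].
  by move=> k; split; [exact: is_field_nilE|exact: is_oneform_nile].
split=> [beta|].
  split.
  - exists (nil_connection beta).
    by split; [exact: nil_connection_is_connection|exact: nil_connection_spec].
  - by move=> nabla nabla' cn sn cn' sn'; exact: nabla_spec_unique cn sn cn' sn'.
  - move=> nabla cn sn; have cC := nil_connection_is_connection beta.
    have E := nabla_spec_unique cn sn cC (nil_connection_spec beta).
    have fb := @is_field_nil_bracket R.
    split.
    + exact: (eq_torsion_free E (nil_connection_torsion_free beta)).
    + exact: (eq_flat cC E fb (nil_connection_flat beta)).
    + exact: (eq_parallel E (nil_connection_parallel beta)).
    + exact: (eq_infinitesimal_automorphism E fb (is_field_nilE i2) (nil_connection_lie beta)).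
    + exact: nilE2_not_symplectic.
exists (nilM R), (nilA R), (nilOmega R), nil_connection; split.
- exact: man.
- exact: nilOmega_symplectic.
- move=> beta beta' bb'; exists (nilE R i2), (nilE R i2).
  by split; [exact: is_field_nilE|exact: is_field_nilE|exact: nil_connection_neq].
- move=> beta; split; last 2 first.
  + exact: nil_connection_flat.
  + exists (nilE R i2).
    by split; [exact: is_field_nilE|exact: nil_connection_lie|exact: nilE2_not_symplectic].
  + split; [exact: nil_connection_is_connection|exact: nil_connection_torsion_free|].
    exact: nil_connection_parallel.
Qed.
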